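(* Let $k\ge 6$ be an integer and let $t$ be a real number with $t\ge 4$. Let $\delta_t$ be the unique positive solution of $\delta_t+\log\delta_t=1-t/k$. Then the exponent $\Delta_t=k\delta_t$ is weight-uniform admissible for $t$; that is, for each $\varepsilon>0$ there exists $\eta>0$ such that whenever $2\le R\le P^\eta$, uniformly over all functions $w:\mathbb N\to\mathbb C$, one has \[ \int_0^1\Big|\sum_{n\in\mathscr A(P,R)}w(n)e(\alpha n^k)\Big|^t\,\mathrm d\alpha\ll \|w\|_P^t\,P^{t-k+k\delta_t+\varepsilon}, \] where $\|w\|_P=\max_{1\le n\le P}|w(n)|$ and the implied constant depends on $\varepsilon,k,t$ but not on $w$.
   Context: For $2\le R\le P$, let $\mathscr A(P,R)$ denote the set of natural numbers not exceeding $P$ all of whose prime factors are at most $R$; $e(z)=\mathrm e^{2\pi i z}$. *)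

(* Defs.v *)
From HB Require Import structures.
From mathcomp Require Import all_boot all_order all_algebra.
From mathcomp Require Import all_classical all_reals all_analysis.
From mathcomp Require Import complex.

Set Implicit Arguments.
Unset Strict Implicit.
Unset Printing Implicit Defensive.

Import Order.TTheory GRing.Theory Num.Theory numFieldNormedType.Exports.
Import Normc.

Local Open Scope ring_scope.
Local Open Scope complex_scope.
Local Open Scope classical_set_scope.

Definition e_ {R : realType} (z : R) : R[i] :=
  cos (2 * pi * z) +i* sin (2 * pi * z).

(* The set A(P, Y); Y plays the role of the smoothness bound usually written
   R, a letter reserved here for the real numbers. *)
Definition smooth_numbers {R : realType} (P Y : R) : pred nat :=
  [pred n : nat | [&& (0 < n)%N, n%:R <= P & all (fun p => p%:R <= Y) (primes n)]].

(* [1, Num.truncn P] is the set of positive integers not exceeding P, so the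
   range of summation excludes no element of A(P, Y). *)
Definition smooth_weyl_sum {R : realType} (k : nat) (P Y : R)
    (w : nat -> R[i]) (alpha : R) : R[i] :=
  \sum_(1 <= n < (Num.truncn P).+1 | n \in smooth_numbers P Y)
    w n * e_ (alpha * n%:R ^+ k).

Definition weight_norm {R : realType} (P : R) (w : nat -> R[i]) : R :=
  \big[Num.max/0]_(1 <= n < (Num.truncn P).+1) normc (w n).

Definition weight_uniform_admissible {R : realType} (k : nat) (t Delta : R) : Prop :=
  forall eps : R, 0 < eps ->
  exists eta : R, 0 < eta /\
  exists C : R, 0 < C /\
  forall P Y : R, 2 <= Y -> Y <= P -> Y <= P `^ eta ->
  forall w : nat -> R[i],
    (\int[@lebesgue_measure R]_(alpha in `[0%R, 1%R])
       (normc (smooth_weyl_sum k P Y w alpha) `^ t)%:E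
     <= (C * weight_norm P w `^ t * P `^ (t - k%:R + Delta + eps))%:E)%E.

(* Main.v *)
(** For an even moment t = 2s the weights can be replaced by their maximum, so
the problem is to bound the number of solutions of x_1^k + ... + x_s^k =
y_1^k + ... + y_s^k in smooth numbers. Wooley's repeated efficient differencing
passes from s to s + 1: add variables z, w with z^k - w^k, extract from all x_i,
y_i a common divisor m of a prescribed size prime to the derivative at z and w,
deduce z = w mod m^k, and replace z^k by ((z + h m^k)^k - z^k) / m^k; this is
repeated k times, with a Cauchy-Schwarz inequality at each stage. The solutions
in which some x_i has no suitable m are so rare that Hoelder's inequality absorbs
them. The exponents 2s - k + k d_s thus obtained satisfy d_(s+1) =
d_s - (2 / k) (d_s / (1 + d_s)) (1 - 2^-k), which is almost Euler's method for
the differential equation d' = - d / (k (1 + d)) solved by the convex curve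
delta_t. The convexity leaves enough room for the error 2^-k, and the chords of
the Euler polygon stay below the curve, so that interpolation between even
moments gives all real t. *)

Require Import Defs.
From mathcomp Require Import all_boot all_order all_algebra.
From mathcomp Require Import all_classical all_reals all_analysis.
From mathcomp Require Import complex measurable_realfun zify ring lra.

Set Implicit Arguments.
Unset Strict Implicit.
Unset Printing Implicit Defensive.

Import Order.TTheory GRing.Theory Num.Theory numFieldNormedType.Exports.
Import Normc.

(** * Counting coincidences *)

Section Counting.
Local Open Scope nat_scope.

(** Two devices keep the argument elementary. All Fourier analysis takes place at the points j / N
    with N larger than every sum involved, where orthogonality is exact; an integral appears only at
    the end, [0, 1) being a union of N translates of [0, 1 / N). Inequalities of Hoelder and
    Cauchy-Schwarz type between moments are used in linear form, such as y^r <= kap y^(r + 1) +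
    kap^-r with a free kap > 0. Thus no roots of counts occur, and a count bounded partly by itself
    can be absorbed into the left side. Two kinds of losses must stay under control. Choosing
    divisors m in (M, M Y] costs powers of Y; prime factors and exceptional integers cost powers
    n^eps. As the number of steps depends only on k and t, the total power of Y depends only on k, t
    and eps, and the condition Y <= P^eta turns it into a small power of P. *)

Definition energy (X : finType) (D : pred X) (f : X -> nat) : nat :=
  \sum_(x | D x) \sum_(y | D y) (f x == f y).

Lemma energy_card (X : finType) (D : pred X) (f : X -> nat) :
  energy D f = #|[pred p : X * X | [&& D p.1, D p.2 & f p.1 == f p.2]]|.
Proof.
rewrite /energy pair_big_dep /= -sum1_card big_mkcond [RHS]big_mkcond /=.
apply: eq_bigr => -[x y] _ /=; rewrite inE /=.
by case: (D x); case: (D y) => //=; case: eqP.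
Qed.

Lemma energy_inj (X X' : finType) (D : pred X) (f : X -> nat)
    (D' : pred X') (f' : X' -> nat) (phi : X -> X') :
    {in D &, injective phi} ->
    (forall x, D x -> D' (phi x)) ->
    (forall x y, D x -> D y -> f x = f y -> f' (phi x) = f' (phi y)) ->
  energy D f <= energy D' f'.
Proof.
move=> inj DD' ff'; rewrite !energy_card.
set A := [pred p | _]; set B := [pred p : X' * X' | _].
pose psi (p : X * X) := (phi p.1, phi p.2).
have injp : {in A &, injective psi}.
  move=> [x y] [x' y'] /and3P[/= Dx Dy _] /and3P[/= Dx' Dy' _] [] e1 e2.
  by rewrite (inj _ _ Dx Dx' e1) (inj _ _ Dy Dy' e2).
rewrite -(card_in_image injp); apply: subset_leq_card.
apply/fintype.subsetP => _ /fintype.imageP[[x y] /= Axy ->].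
case/and3P: Axy => /= Dx Dy /eqP exy.
by rewrite inE /= !DD' //= (ff' x y).
Qed.

Lemma energy_sub (X : finType) (D D' : pred X) (f : X -> nat) :
  (forall x, D x -> D' x) -> energy D f <= energy D' f.
Proof. by move=> DD'; apply: (@energy_inj _ _ _ _ _ _ id). Qed.

Lemma cross_count (X Y : finType) (D : pred X) (E : pred Y)
    (f : X -> nat) (g : Y -> nat) (B : nat) :
    (forall x, D x -> f x < B) ->
  \sum_(x | D x) \sum_(y | E y) (f x == g y) =
  \sum_(v < B) (\sum_(x | D x) (f x == v)) * (\sum_(y | E y) (g y == v)).
Proof.
move=> fB.
transitivity (\sum_(v < B) \sum_(x | D x) \sum_(y | E y)
    (f x == v) * (g y == v)); last first.
  by apply: eq_bigr => v _; rewrite big_distrlr.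
rewrite [RHS]exchange_big /=; apply: eq_bigr => x Dx.
rewrite [RHS]exchange_big /=; apply: eq_bigr => y Ey.
rewrite (bigD1 (Ordinal (fB x Dx))) //= eqxx mul1n big1 ?addn0 1?eq_sym //.
by move=> v; rewrite -val_eqE /= eq_sym => /negPf ->.
Qed.

Lemma energy_sq (X : finType) (D : pred X) (f : X -> nat) (B : nat) :
    (forall x, D x -> f x < B) ->
  energy D f = \sum_(v < B) (\sum_(x | D x) (f x == v)) ^ 2.
Proof. exact: cross_count. Qed.

Lemma cauchy_schwarz_sumn (I : finType) (S : pred I) (a : I -> nat) :
  (\sum_(i | S i) a i) ^ 2 <= #|S| * \sum_(i | S i) a i ^ 2.
Proof.
have le2 : 2 * (\sum_(i | S i) a i) ^ 2 <=
    \sum_(i | S i) \sum_(j | S j) (a i ^ 2 + a j ^ 2).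
  rewrite -mulnn big_distrlr /= big_distrr /=; apply: leq_sum => i _.
  by rewrite big_distrr /=; apply: leq_sum => j _; exact: nat_Cauchy.
have eq2 : \sum_(i | S i) \sum_(j | S j) (a i ^ 2 + a j ^ 2) =
    2 * (#|S| * \sum_(i | S i) a i ^ 2).
  under eq_bigr do rewrite big_split /= sum_nat_const.
  by rewrite big_split /= sum_nat_const -big_distrr /= mul2n addnn.
by rewrite eq2 leq_pmul2l in le2.
Qed.

(** Cauchy-Schwarz on each fibre of [f], split by colour. It makes a choice attached to a solution
    (a divisor, a residue class, a value) the same on both sides of the equation, at the cost of a
    factor [#|S|]. *)
Lemma energy_colour (X K : finType) (D : pred X) (f : X -> nat)
    (S : pred K) (kap : X -> K) :
    (forall x, D x -> S (kap x)) ->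
  energy D f <=
  #|S| * \sum_(c | S c) energy [pred x | D x && (kap x == c)] f.
Proof.
move=> DS; pose B := (\max_x f x).+1.
have fB x : f x < B by rewrite ltnS leq_bigmax.
rewrite (@energy_sq _ _ _ B) //.
under [X in _ * X]eq_bigr do rewrite (@energy_sq _ _ _ B) //.
rewrite exchange_big big_distrr /=; apply: leq_sum => v _.
apply: leq_trans (cauchy_schwarz_sumn _ _); rewrite leq_sqr.
by rewrite (partition_big kap S).
Qed.

End Counting.

(** * Exponential sums at the points j / N *)

Section FiniteFourier.
Local Open Scope ring_scope.
Variable R : realType.

Lemma e_D (x y : R) : e_ (x + y) = e_ x * e_ y.
Proof.
apply/eqP; rewrite /e_ mulrDr cosD sinD eq_complex /=.
by rewrite eqxx /= addrC.
Qed.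

Lemma e_0 : e_ (0 : R) = 1.
Proof. by apply/eqP; rewrite /e_ mulr0 cos0 sin0 eq_complex /= !eqxx. Qed.

Lemma e_1 : e_ (1 : R) = 1.
Proof.
apply/eqP; rewrite /e_ mulr1 mulr_natl eq_complex /= cos2pi eqxx /=.
by rewrite mulr2n sinD cospi sinpi mulr0 mul0r addr0.
Qed.

Lemma e_mulrn (x : R) (n : nat) : e_ (x * n%:R) = e_ x ^+ n.
Proof.
elim: n => [|n IHn]; first by rewrite mulr0 e_0.
by rewrite -natr1 mulrDr mulr1 e_D IHn exprSr.
Qed.

Lemma e_nat (n : nat) : e_ (n%:R : R) = 1.
Proof. by rewrite -[n%:R]mul1r e_mulrn e_1 expr1n. Qed.

Lemma e_sum (I : Type) (r : seq I) (P : pred I) (F : I -> R) :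
  e_ (\sum_(i <- r | P i) F i) = \prod_(i <- r | P i) e_ (F i).
Proof. exact: (big_morph e_ e_D e_0). Qed.

Lemma conj_e (x : R) : conjc (e_ x) = e_ (- x).
Proof. by rewrite /e_ mulrN cosN sinN. Qed.

Lemma normc_e (x : R) : normc (e_ x) = 1.
Proof. by rewrite /normc /e_ cos2Dsin2 sqrtr1. Qed.

Lemma e_neq1 (x : R) : 0 < `|x| < 1 -> e_ x != 1.
Proof.
have pos (y : R) : 0 < y < 1 -> e_ y != 1.
  move=> /andP[y0 y1]; apply/eqP => -[c1 _].
  have s0 : 0 < sin (pi * y).
    by apply: sin_gt0_pi; rewrite mulr_gt0 ?pi_gt0 //= gtr_pMr ?pi_gt0.
  (* By the double angle formula, cos (2 pi y) = 1 would force sin (pi y) = 0. *)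
  have e2 : 2 * pi * y = pi * y + pi * y by ring.
  move: c1 (cos2Dsin2 (pi * y)); rewrite e2 cosD => c1 c2.
  have : 0 < sin (pi * y) ^+ 2 by rewrite exprn_gt0.
  by rewrite !expr2 in c2 *; lra.
case: (ltrP x 0) => x0 xb; last by apply: pos; rewrite ger0_norm in xb.
have := pos (- x); rewrite ltr0_norm // in xb => /(_ xb).
by apply: contra => /eqP e1; rewrite -conj_e e1 conjc1.
Qed.

(** For p <> q the ratio [z] is an N-th root of unity other than 1, because |p - q| < N, and the
    geometric sum vanishes. *)
Lemma e_orthogonality (N p q : nat) : (p < N)%N -> (q < N)%N ->
  \sum_(j < N) e_ (j%:R / N%:R * p%:R) * conjc (e_ (j%:R / N%:R * q%:R))
  = (N * (p == q))%:R :> R[i].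
Proof.
move=> pN qN; have N0 : (N%:R : R) != 0 by rewrite pnatr_eq0; case: N pN qN.
pose z : R[i] := e_ ((p%:R - q%:R) / N%:R).
under eq_bigr => j _.
  rewrite conj_e -e_D.
  have -> : j%:R / N%:R * p%:R - j%:R / N%:R * q%:R
    = (p%:R - q%:R) / N%:R * j%:R :> R by ring.
  rewrite e_mulrn -/z; over.
have [epq|neq] := eqVneq p q.
  rewrite muln1 /z epq subrr mul0r e_0.
  by under eq_bigr do rewrite expr1n; rewrite sumr_const card_ord.
have z1 : z != 1.
  apply: e_neq1; rewrite normr_gt0 mulf_neq0 ?invr_eq0 //; last first.
    by rewrite subr_eq0 eqr_nat.
  rewrite normrM normfV (gtr0_norm (_ : 0 < N%:R)) ?lt0r ?N0 ?ler0n //.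
  rewrite ltr_pdivrMr ?lt0r ?N0 ?ler0n // mul1r ltr_norml.
  have : (p%:R : R) < N%:R /\ (q%:R : R) < N%:R by rewrite !ltr_nat.
  have : 0 <= (p%:R : R) /\ 0 <= (q%:R : R) by [].
  by move=> [? ?] [? ?]; apply/andP; split; lra.
have zN : z ^+ N = 1.
  by rewrite /z -e_mulrn divfK // e_D -conj_e !e_nat conjc1 mulr1.
apply/eqP; rewrite muln0 -(mulrI_eq0 _ (lregP (_ : z - 1 != 0))) ?subr_eq0 //.
by rewrite -subrX1 zN subrr.
Qed.

Definition expsum (X : finType) (D : pred X) (c : X -> R[i]) (f : X -> nat)
    (a : R) : R[i] :=
  \sum_(x | D x) c x * e_ (a * (f x)%:R).

Lemma normc_sqr (z : R[i]) : ((normc z ^+ 2)%:C)%C = z * conjc z.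
Proof. by rewrite -sqr_normc rmorphXn. Qed.

Lemma normc_sum (I : Type) (r : seq I) (P : pred I) (F : I -> R[i]) :
  normc (\sum_(i <- r | P i) F i) <= \sum_(i <- r | P i) normc (F i).
Proof.
elim/big_rec2: _ => [|i u v _ le]; first by rewrite normc0.
by apply: le_trans (le_normcD _ _) _; rewrite lerD2l.
Qed.

Lemma normc_prod (I : Type) (r : seq I) (P : pred I) (F : I -> R[i]) :
  normc (\prod_(i <- r | P i) F i) = \prod_(i <- r | P i) normc (F i).
Proof. exact: (big_morph _ (@normcM R) (normc1 R)). Qed.

Lemma normcX (z : R[i]) (n : nat) : normc (z ^+ n) = normc z ^+ n.
Proof. by elim: n => [|n IHn]; rewrite ?normc1 // !exprS normcM IHn. Qed.

Lemma normcR (x : R) : normc (x%:C)%C = `|x|.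
Proof. by rewrite /= expr0n addr0 sqrtr_sqr. Qed.

Lemma normc_ge0 (z : R[i]) : 0 <= normc z.
Proof. by case: z => ? ?; rewrite sqrtr_ge0. Qed.

Lemma conj_normc (z : R[i]) : normc (conjc z) = normc z.
Proof. by case: z => u v /=; rewrite sqrrN. Qed.

Lemma parseval (X : finType) (D : pred X) (c : X -> R[i]) (f : X -> nat)
    (N : nat) :
    (forall x, D x -> (f x < N)%N) ->
  \sum_(j < N) ((normc (expsum D c f (j%:R / N%:R)) ^+ 2)%:C)%C =
  \sum_(x | D x) \sum_(y | D y) (N * (f x == f y))%:R * (c x * conjc (c y)).
Proof.
move=> fN.
under eq_bigr => j _.
  rewrite normc_sqr /expsum rmorph_sum big_distrlr /=; over.
rewrite exchange_big /=; apply: eq_bigr => x Dx.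
rewrite exchange_big /=; apply: eq_bigr => y Dy.
rewrite -e_orthogonality ?fN // mulr_suml; apply: eq_bigr => j _.
by rewrite rmorphM /= mulrACA mulrC.
Qed.

Lemma parseval_energy (X : finType) (D : pred X) (f : X -> nat) (N : nat) :
    (forall x, D x -> (f x < N)%N) ->
  \sum_(j < N) normc (expsum D (fun=> 1) f (j%:R / N%:R)) ^+ 2 =
  (N * energy D f)%:R.
Proof.
move=> fN; apply: (@complexI R); rewrite rmorph_sum /= parseval //.
rewrite /energy rmorph_nat big_distrr natr_sum /=; apply: eq_bigr => x _.
rewrite big_distrr natr_sum /=; apply: eq_bigr => y _.
by rewrite oppr0 mul1r; exact: mulr1.
Qed.

(** Expanding the square leaves only the nonnegative coefficients [N * (f x == f y)], so every
    product of two weights may be replaced by W^2. This is how the weights disappear. *)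
Lemma weighted_parseval_le (X : finType) (D : pred X) (c : X -> R[i])
    (f : X -> nat) (N : nat) (W : R) :
    (forall x, D x -> (f x < N)%N) -> (forall x, D x -> normc (c x) <= W) ->
  \sum_(j < N) normc (expsum D c f (j%:R / N%:R)) ^+ 2 <=
  N%:R * (W ^+ 2 * (energy D f)%:R).
Proof.
move=> fN cW.
have := congr1 (@normc R) (parseval c fN).
rewrite -rmorph_sum normcR ger0_norm; last first.
  by apply: sumr_ge0 => j _; rewrite exprn_ge0 ?normc_ge0.
move=> ->; apply: le_trans (normc_sum _ _ _) _.
rewrite /energy natr_sum !mulr_sumr; apply: ler_sum => x Dx.
apply: le_trans (normc_sum _ _ _) _.
rewrite natr_sum !mulr_sumr; apply: ler_sum => y Dy.
rewrite !normcM conj_normc.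
have -> : normc (N * (f x == f y))%:R = (N * (f x == f y))%:R :> R.
  by rewrite -[X in normc X](rmorph_nat (real_complex R)) normcR ger0_norm.
rewrite natrM -mulrA ler_wpM2l // mulrC ler_wpM2r //.
by rewrite expr2 ler_pM ?normc_ge0 ?cW.
Qed.

End FiniteFourier.

(** * Inequalities of Hoelder type for mixed systems *)

Section MixedEnergy.
Local Open Scope ring_scope.
Variable R : realType.

Definition ffun_dom (Y : finType) (s : nat) (E : 'I_s -> pred Y) :
  pred {ffun 'I_s -> Y} := [pred u : {ffun 'I_s -> Y} | [forall i, E i (u i)]].

Definition ffun_sum (Y : finType) (s : nat) (g : 'I_s -> Y -> nat)
  (u : {ffun 'I_s -> Y}) : nat := (\sum_i g i (u i))%N.

(** Domains and maps depend on the index because the divisors extracted from the variables differ at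
    first, and because one variable is sometimes frozen. *)
Definition mixed_energy (X Y : finType) (s : nat) (D : pred X) (F : X -> nat)
    (E : 'I_s -> pred Y) (g : 'I_s -> Y -> nat) : nat :=
  energy [pred p : X * {ffun 'I_s -> Y} | D p.1 && ffun_dom E p.2]
    (fun p => F p.1 + ffun_sum g p.2)%N.

Lemma expsum_ffun (Y : finType) (s : nat) (E : 'I_s -> pred Y)
    (c : 'I_s -> Y -> R[i]) (g : 'I_s -> Y -> nat) (a : R) :
  \prod_i expsum (E i) (c i) (g i) a =
  expsum (ffun_dom E) (fun u => \prod_i c i (u i)) (ffun_sum g) a.
Proof.
rewrite /expsum bigA_distr_big_dep; apply: eq_big => u.
  by apply/familyP/forallP.
by move=> _; rewrite big_split /= /ffun_sum natr_sum mulr_sumr e_sum.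
Qed.

Lemma mixed_energy_fourier (X Y : finType) (s : nat) (D : pred X)
    (F : X -> nat) (E : 'I_s -> pred Y) (g : 'I_s -> Y -> nat) (N : nat) :
    (forall x u, F x + ffun_sum g u < N)%N ->
  (N * mixed_energy D F E g)%:R =
  \sum_(j < N) (normc (expsum D (fun=> 1) F (j%:R / N%:R)) ^+ 2 *
    \prod_i normc (expsum (E i) (fun=> 1) (g i) (j%:R / N%:R)) ^+ 2) :> R.
Proof.
move=> FN; rewrite -parseval_energy => [|[x u] _]; last exact: FN.
apply: eq_bigr => j _; set a := _ / _.
rewrite prodrXl -normc_prod -exprMn -normcM expsum_ffun; congr (normc _ ^+ 2).
rewrite /expsum big_distrlr /= pair_big /=; apply: eq_bigr => -[x u] _ /=.
by rewrite natrD mulrDr e_D !mul1r big1_eq mul1r.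
Qed.

(** All factors are compared with the largest one. Averaged over the points j / N, this serves as
    Hoelder's inequality. *)
Lemma prod_le_sum_expr (s : nat) (q : 'I_s.+1 -> R) : (forall i, 0 <= q i) ->
  \prod_i q i <= \sum_i q i ^+ s.+1.
Proof.
move=> q0; have [i0 _ qi0] := @arg_maxP _ _ _ ord0 xpredT q isT.
apply: (@le_trans _ _ (q i0 ^+ s.+1)).
  rewrite -[X in _ ^+ X]card_ord -prodr_const; apply: ler_prod => i _.
  by rewrite q0; exact: qi0.
by rewrite (bigD1 i0) //= lerDl sumr_ge0 // => i _; rewrite exprn_ge0.
Qed.

(** Either kap y >= 1 and one more factor kap y is harmless, or y < kap^-1. After averaging, the
    best kap would give Hoelder's inequality between moments up to a constant. *)
Lemma expr_le_interp (y kap : R) (r : nat) : 0 <= y -> 0 < kap ->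
  y ^+ r <= kap * y ^+ r.+1 + kap^-1 ^+ r.
Proof.
move=> y0 k0; case: (lerP 1 (kap * y)) => ky.
  apply: ler_wpDr; first by rewrite exprn_ge0 // invr_ge0 ltW.
  by rewrite exprS mulrA ler_peMl ?exprn_ge0.
apply: ler_wpDl; first by rewrite mulr_ge0 ?exprn_ge0 // ltW.
rewrite lerXn2r ?nnegrE //.
  by rewrite invr_ge0 ltW.
by rewrite -[_^-1]mul1r ler_pdivlMr // mulrC ltW.
Qed.

Lemma mixed_energy_hoelder (X Y : finType) (s : nat) (D : pred X)
    (F : X -> nat) (E : 'I_s -> pred Y) (g : 'I_s -> Y -> nat) : (0 < s)%N ->
  (mixed_energy D F E g <=
   \sum_i mixed_energy D F (fun _ : 'I_s => E i) (fun=> g i))%N.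
Proof.
case: s E g => // s E g _.
pose N := (\max_x F x + s.+1 * \max_(p : 'I_s.+1 * Y) g p.1 p.2).+1.
have gN i y : (g i y <= \max_(p : 'I_s.+1 * Y) g p.1 p.2)%N.
  exact: (leq_bigmax (i, y)).
have FN (x : X) (w : 'I_s.+1 -> Y -> nat) (u : {ffun 'I_s.+1 -> Y}) :
    (forall i y, w i y <= \max_(p : 'I_s.+1 * Y) g p.1 p.2)%N ->
    (F x + ffun_sum w u < N)%N.
  move=> wN; rewrite /N ltnS leq_add ?leq_bigmax //.
  rewrite -[X in (_ <= X * _)%N](card_ord s.+1) -sum_nat_const.
  by apply: leq_sum => i _; exact: wN.
rewrite -(@leq_pmul2l N) // -(ler_nat R) mixed_energy_fourier; last first.
  by move=> x u; apply: FN.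
rewrite big_distrr natr_sum /=.
under [leRHS]eq_bigr => i _.
  rewrite mixed_energy_fourier; last by move=> x u; apply: FN.
  over.
rewrite exchange_big /=; apply: ler_sum => j _.
rewrite -mulr_sumr ler_wpM2l ?exprn_ge0 ?normc_ge0 //.
under [leRHS]eq_bigr do rewrite prodr_const card_ord.
by apply: prod_le_sum_expr => i; rewrite exprn_ge0 ?normc_ge0.
Qed.

Lemma mixed_energy_interp (X Y : finType) (s : nat) (D : pred X)
    (F : X -> nat) (E : pred Y) (g : Y -> nat) (i0 : 'I_s.+1) (v : Y)
    (kap : R) : 0 < kap ->
  (mixed_energy D F (fun i => if i == i0 then (pred1 v : pred Y) else E) (fun=> g))%:R <=
  kap * (mixed_energy D F (fun _ : 'I_s.+1 => E) (fun=> g))%:R +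
  kap^-1 ^+ s * (energy D F)%:R.
Proof.
move=> k0; pose N := (\max_x F x + s.+1 * \max_y g y).+1.
have FN (x : X) (u : {ffun 'I_s.+1 -> Y}) : (F x + ffun_sum (fun=> g) u < N)%N.
  rewrite /N ltnS leq_add ?leq_bigmax //.
  rewrite -[X in (_ <= X * _)%N](card_ord s.+1) -sum_nat_const.
  by apply: leq_sum => i _; exact: leq_bigmax.
have F1 x : (F x < N)%N by rewrite /N ltnS (leq_trans (leq_bigmax x)) ?leq_addr.
rewrite -(ler_pM2l (_ : 0 < N%:R)) ?ltr0n // mulrDr !(mulrCA N%:R) -!natrM.
rewrite !mixed_energy_fourier // -parseval_energy // !mulr_sumr -big_split /=.
apply: ler_sum => j _; set a := _ / _.
rewrite (bigD1 i0) //= eqxx.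
have -> : normc (expsum (pred1 v) (fun=> 1) g a) = 1.
  by rewrite /expsum big_pred1_eq mul1r normc_e.
under eq_bigr => i /negPf ii0 do rewrite ii0.
rewrite expr1n mul1r !prodr_const card_ord cardC1 card_ord /=.
rewrite [X in _ + X]mulrC mulrCA -mulrDr ler_wpM2l ?exprn_ge0 ?normc_ge0 //.
by apply: expr_le_interp; rewrite ?exprn_ge0 ?normc_ge0.
Qed.

Lemma weighted_moment_le (X : finType) (D : pred X) (c : X -> R[i])
    (f : X -> nat) (s N : nat) (W : R) :
    (forall u : {ffun 'I_s -> X}, ffun_sum (fun=> f) u < N)%N ->
    (forall x, D x -> normc (c x) <= W) ->
  \sum_(j < N) normc (expsum D c f (j%:R / N%:R)) ^+ (2 * s) <=
  N%:R * (W ^+ (2 * s) *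
    (energy (ffun_dom (fun _ : 'I_s => D)) (ffun_sum (fun=> f)))%:R).
Proof.
move=> fN cW; rewrite mulnC exprM.
have cW' u : ffun_dom (fun _ : 'I_s => D) u ->
    normc (\prod_i c (u i)) <= W ^+ s.
  move=> /forallP Du; rewrite normc_prod -[X in W ^+ X]card_ord -prodr_const.
  by apply: ler_prod => i _; rewrite normc_ge0 cW.
apply: le_trans (weighted_parseval_le (fun u _ => fN u) cW').
apply: ler_sum => j _; rewrite exprM -normcX; set a := _ / _.
rewrite -[X in normc (_ ^+ X)](card_ord s) -prodr_const.
by rewrite (expsum_ffun (fun=> D) (fun=> c) (fun=> f)).
Qed.

End MixedEnergy.

(** * Congruences and smooth divisors *)

Section NatPolynomials.
Local Open Scope nat_scope.
Implicit Types (p q : {poly nat}).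

Local Notation "p .[ x ]" := (horner p x%N).
Local Notation "p '^`' ()" := (deriv p) (format "p '^`' ()").

(** The remainder [E] is again a natural number. This replaces the factorisation of p(z) - p(w), as
    subtraction in [nat] is truncated. *)
Lemma horner_taylor2 p (w h : nat) :
  exists E, p.[w + h] = p.[w] + h * (p^`().[w] + h * E).
Proof.
have comm_wh : GRing.comm w h by exact: mulnC.
have taylor := @nderiv_taylor_wide _ (size p).+2 p w h comm_wh (leqW (leqnSn _)).
rewrite -[(w + h)%N]/(w + h)%R taylor.
rewrite big_ord_recl big_ord_recl /= nderivn0 nderivn1.
exists (\sum_(i < size p) (horner (nderivn i.+2 p) w) * h ^ i)%N.
rewrite mulnDr; congr (_ + (_ + _)).
- by rewrite expr0 mulr1.
- by rewrite expr1 mulrC.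
rewrite !big_distrr /=; apply: eq_bigr => i _.
rewrite -[(h ^ i)%N]/(h ^+ i)%R.
by rewrite [LHS]mulrC !exprS -!mulrA; do 2!congr (_ * _)%R; rewrite mulrC.
Qed.

Lemma coprime_prime_dvd (n m : nat) : 0 < m ->
  (forall l, prime l -> l %| m -> ~~ (l %| n)) -> coprime n m.
Proof.
move=> m0 H; apply: contraT => ncop.
have g1 : 1 < gcdn n m by rewrite ltn_neqAle eq_sym ncop gcdn_gt0 m0 orbT.
have := H _ (pdiv_prime g1) (dvdn_trans (pdiv_dvd _) (dvdn_gcdr _ _)).
by rewrite (dvdn_trans (pdiv_dvd _) (dvdn_gcdl _ _)).
Qed.

Lemma coprime_ndvd_prime (n m l : nat) :
  coprime n m -> prime l -> l %| m -> ~~ (l %| n).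
Proof.
move=> cop lp lm; rewrite -prime_coprime // coprime_sym.
exact: coprime_dvdr lm cop.
Qed.

(* Uniqueness in Hensel's lemma: p.[z] - p.[w] = (z - w) * c with c prime
   to m, because c is congruent to p^`().[w] modulo each prime factor of m. *)
Lemma eq_modn_of_deriv_coprime p (m e z w : nat) : 0 < m ->
    (forall l, prime l -> l %| m -> z = w %[mod l]) ->
    coprime p^`().[z] m -> coprime p^`().[w] m ->
    p.[z] = p.[w] %[mod m ^ e] -> z = w %[mod m ^ e].
Proof.
move=> m0; wlog le_wz : z w / w <= z.
  move=> IH eq_zw cz cw epzw; case: (leqP w z) => [|/ltnW] le; first exact: IH.
  by apply/esym; apply: IH => // l lp lm; apply/esym/eq_zw.
move=> eq_zw _ cw /eqP.
have [E pz] := horner_taylor2 p w (z - w); rewrite subnKC // in pz.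
rewrite eqn_mod_dvd pz ?leq_addr // addKn Gauss_dvdl => [dvd|].
  by apply/eqP; rewrite eqn_mod_dvd.
apply: coprimeXl; rewrite coprime_sym; apply: coprime_prime_dvd => // l lp lm.
have /eqP := eq_zw l lp lm; rewrite eqn_mod_dvd // => dvd.
by rewrite dvdn_addl ?dvdn_mulr // (coprime_ndvd_prime cw).
Qed.

Definition roots_mod p (l rho : nat) : seq nat :=
  [seq r <- iota 0 l | p.[r] == rho %[mod l]].

Lemma mem_roots_mod p (l z rho : nat) : prime l ->
  p.[z] = rho %[mod l] -> z %% l \in roots_mod p l rho.
Proof.
move=> lp pz; rewrite mem_filter mem_iota add0n ltn_pmod ?prime_gt0 // andbT.
apply/eqP; rewrite -pz; apply/eqP.
have [E pzE] := horner_taylor2 p (z %% l) (z %/ l * l).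
have -> : p.[z] = p.[z %% l + z %/ l * l] by rewrite addnC -divn_eq.
by rewrite pzE -mulnA -modnDmr (mulnCA _ l) modnMr addn0 eqxx.
Qed.

(** The derivative at [z] excludes that p is constant modulo l, so p - rho is a nonzero polynomial
    of degree at most k over the field with l elements. *)
Lemma size_roots_mod p (k l z rho : nat) : prime l -> size p <= k.+1 ->
  ~~ (l %| p^`().[z]) -> size (roots_mod p l rho) <= k.
Proof.
move=> lp szp ndvd.
pose f : {rmorphism nat -> 'F_l} := (GRing.natmul (1 : 'F_l))%R.
pose q := (map_poly f p - (f rho)%:P)%R.
have charl : l \in [pchar 'F_l]%R by exact: pchar_Fp.
have q0 : q != 0%R.
  apply: contraNneq ndvd => q0.
  rewrite (dvdn_pcharf charl) -[X in X == _]/(f _) -horner_map -deriv_map.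
  have -> : ((map_poly f p)^`() = q^`())%R by rewrite derivB derivC subr0.
  by rewrite q0 deriv0 horner0.
have szq : size q <= k.+1.
  apply: leq_trans (size_polyD _ _) _; rewrite size_polyN geq_max.
  rewrite (leq_trans (size_poly _ _)) //=.
  by rewrite (leq_trans (size_polyC_leq1 _)).
have inj : {in roots_mod p l rho &, injective f}.
  move=> x y; rewrite !mem_filter !mem_iota !add0n /= => /andP[_ xl] /andP[_ yl].
  move=> /(congr1 val) /=; rewrite !val_Fp_nat // !modn_small //.
have := @max_poly_roots _ q (map f (roots_mod p l rho)) q0.
rewrite size_map => mpr; rewrite -ltnS (leq_trans _ szq) //; apply: mpr.
  apply/allP => _ /mapP[r rin ->].
  move: rin; rewrite mem_filter => /andP[/eqP er _].
  rewrite /root !hornerE horner_map subr_eq0; apply/eqP.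
  by apply: val_inj => /=; rewrite !val_Fp_nat.
by rewrite map_inj_in_uniq // filter_uniq ?iota_uniq.
Qed.

(** For each prime l dividing m, the rank of the class of z among the solutions r of p(r) = p(z)
    modulo l. A rank instead of a residue leaves only k + 1 colours per prime, however large l
    is. *)
Definition residue_colour (k : nat) p (m z : nat) :
    {ffun 'I_(size (primes m)) -> 'I_k.+1} :=
  [ffun i : 'I_(size (primes m)) => let l := nth 0 (primes m) i in
             inord (index (z %% l) (roots_mod p l (p.[z] %% l)))].

(** Congruent values have the same list of roots modulo l, so equal ranks mean equal residues;
    uniqueness in Hensel's lemma lifts the congruence to m^e. *)
Lemma residue_colour_inj (k : nat) p (m e z w : nat) :
    size p <= k.+2 -> 0 < m -> 0 < e ->
    coprime p^`().[z] m -> coprime p^`().[w] m ->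
    p.[z] = p.[w] %[mod m ^ e] ->
    residue_colour k p m z = residue_colour k p m w ->
  z = w %[mod m ^ e].
Proof.
move=> szp m0 e0 cz cw ezw ecol.
apply: (eq_modn_of_deriv_coprime m0 _ cz cw ezw) => l lp lm.
have lpm : l \in primes m by rewrite mem_primes lp m0.
have lmod : p.[z] = p.[w] %[mod l].
  have lme : l %| m ^ e by rewrite dvdn_exp.
  by rewrite -(modn_dvdm p.[z] lme) ezw modn_dvdm.
move/ffunP/(_ (Ordinal (etrans (index_mem _ _) lpm))): ecol.
rewrite !ffunE /= nth_index // -lmod => /(congr1 val) /=.
have szr : size (roots_mod p l (p.[z] %% l)) <= k.+1.
  exact: size_roots_mod (coprime_ndvd_prime cz lp lm).
have zr : z %% l \in roots_mod p l (p.[z] %% l).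
  by apply: mem_roots_mod; rewrite ?modn_mod.
have wr : w %% l \in roots_mod p l (p.[z] %% l).
  by apply: mem_roots_mod; rewrite ?modn_mod.
rewrite !inordK ?(leq_trans _ szr) ?index_mem // => eqi.
by rewrite -[LHS](nth_index 0 zr) eqi nth_index.
Qed.

(* The modified difference (p(X + h m^k) - p(X)) / m^k, which has natural
   coefficients by Taylor's formula. *)
Definition mod_diff (k h m : nat) p : {poly nat} :=
  (\sum_(i < size p) p^`N(i.+1) *+ (h ^ i.+1 * m ^ (k * i))%N)%R.

Lemma horner_mod_diff (k h m x : nat) p :
  p.[x + h * m ^ k] = p.[x] + m ^ k * (mod_diff k h m p).[x].
Proof.
have comm_xh : GRing.comm x (h * m ^ k)%N by exact: mulnC.
have taylor := @nderiv_taylor_wide _ (size p).+1 p x _ comm_xh (leqnSn _).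
rewrite -[(x + h * m ^ k)%N]/(x + (h * m ^ k)%N)%R taylor.
rewrite big_ord_recl /= nderivn0 expr0 mulr1; congr (_ + _).
rewrite /mod_diff horner_sum big_distrr /=; apply: eq_bigr => i _.
rewrite hornerMn -[(_ *+ _)%R]mulr_natr natn.
rewrite -[((h * m ^ k)%N ^+ _)%R]/((h * m ^ k) ^ i.+1)%N.
rewrite ssrnat.expnMn -(ssrnat.expnM m) mulnS ssrnat.expnD.
rewrite -[LHS]/(_ * (_ * (_ * _)))%N -[RHS]/(_ * (_ * (_ * _)))%N.
by rewrite (mulnCA (h ^ _)) mulnCA.
Qed.

(** What survives k - r differencing steps with shifts at most n. For r >= 1 the positive
    coefficient makes the derivative positive, hence p injective, at positive integers. The growth
    bound keeps the derivative polynomially bounded in n, so that it has few prime factors. *)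
Record weyl_poly (k n r : nat) p : Prop := WeylPoly {
  weyl_size : size p <= k.+1;
  weyl_coef : 0 < nth 0 p r;
  weyl_horner : forall x, p.[x] <= (x + (k - r) * n) ^ k }.

Lemma weyl_polyXn (k n : nat) : weyl_poly k n k ('X^k)%R.
Proof.
split=> [||x]; first by rewrite size_polyXn.
  by rewrite coefXn eqxx.
by rewrite hornerXn subnn addn0.
Qed.

(** In the term i = 0 of the modified difference q, the coefficient of X^r is (r + 1) h times that
    of X^(r + 1) in p. The growth bound comes from m^k q(x) <= p(x + h m^k), a shift by at most
    n. *)
Lemma weyl_mod_diff (k n r h m : nat) p : r < k -> 0 < h -> 0 < m ->
  h * m ^ k <= n -> weyl_poly k n r.+1 p -> weyl_poly k n r (mod_diff k h m p).
Proof.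
move=> rk h0 m0 hmn [szp cp hp]; split=> [||x].
- apply/leq_sizeP => j kj; rewrite coef_sum big1 // => i _.
  rewrite coefMn coef_nderivn nth_default ?mul0rn //.
  by rewrite (leq_trans szp) // (leq_trans kj) // leq_addl.
- rewrite coef_sum.
  have p0 : 0 < size p.
    by rewrite lt0n; apply: contraTneq cp => /size0nil ->; rewrite nth_nil.
  rewrite (bigD1 (Ordinal p0)) //= -[(_ + _)%R]/(_ + _)%N addn_gt0.
  rewrite coefMn coef_nderivn muln0 expn0 muln1 expn1 bin1 add1n.
  by rewrite -[(_ *+ h)%R]mulr_natr natn -[(_ *+ r.+1)%R]mulr_natr natn !muln_gt0 cp h0.
have mk0 : 0 < m ^ k by rewrite expn_gt0 m0.
apply: (@leq_trans (m ^ k * (mod_diff k h m p).[x])).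
  by rewrite leq_pmull.
apply: (@leq_trans p.[x + h * m ^ k]).
  by rewrite horner_mod_diff leq_addl.
have k0 : 0 < k by exact: leq_trans rk.
apply: leq_trans (hp _) _; rewrite leq_exp2r //.
by rewrite -addnA leq_add2l -(subnSK rk) mulSn leq_add2r.
Qed.

Lemma weyl_deriv_gt0 (k n r z : nat) p :
  weyl_poly k n r.+1 p -> 0 < z -> 0 < p^`().[z].
Proof.
move=> [_ cp _] z0; rewrite horner_coef.
have cr : 0 < nth 0 p^`() r.
  by rewrite coef_deriv -[(_ *+ r.+1)%R]mulr_natr natn muln_gt0 cp.
have rs : r < size p^`().
  by rewrite ltnNge; apply: contraTN cr => le; rewrite nth_default.
rewrite (bigD1 (Ordinal rs)) //= -[(_ + _)%R]/(_ + _)%N addn_gt0.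
by rewrite -[(_ * _)%R]/(_ * _)%N muln_gt0 cr expn_gt0 z0.
Qed.

Lemma weyl_horner_inj (k n r z w : nat) p :
  weyl_poly k n r.+1 p -> 0 < z -> 0 < w -> p.[z] = p.[w] -> z = w.
Proof.
move=> wp; wlog lt_zw : z w / z <= w.
  move=> IH z0 w0 e; case: (leqP z w) => [|/ltnW] le; first exact: IH.
  by apply/esym; apply: IH.
move=> z0 w0; have [E pw] := horner_taylor2 p z (w - z).
rewrite subnKC // in pw; rewrite pw => e.
have d0 := weyl_deriv_gt0 wp z0.
have : (w - z) * (p^`().[z] + (w - z) * E) = 0 by lia.
by move/eqP; rewrite muln_eq0 addn_eq0 => /orP[|/andP[]]; lia.
Qed.

(** All terms of Taylor's formula being nonnegative, p'(z) <= p(z + 1). *)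
Lemma weyl_deriv_le (k n r z : nat) p : weyl_poly k n r p ->
  0 < n -> z <= n -> p^`().[z] <= (k.+2 * n) ^ k.
Proof.
move=> [_ _ hp] n0 zn; have [E pz] := horner_taylor2 p z 1.
apply: (@leq_trans p.[z + 1]); first by rewrite pz; lia.
apply: leq_trans (hp _) _; case: k {hp} => [|k]; first by [].
by rewrite leq_exp2r //; nia.
Qed.

End NatPolynomials.

(** * Divisors of prescribed size, and the rare integers without one *)

Section SmoothDivisors.
Local Open Scope ring_scope.
Variable R : realType.

Definition smooth_nat (Y x : nat) : bool :=
  (0 < x)%N && all (fun l => l <= Y)%N (primes x).

Lemma smooth_nat_dvd (Y d x : nat) :
  (d %| x)%N -> smooth_nat Y x -> smooth_nat Y d.
Proof.
move=> dx /andP[x0 /allP sx]; rewrite /smooth_nat (dvdn_gt0 x0 dx) /=.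
apply/allP => l; rewrite mem_primes => /and3P[lp _ ld]; apply: sx.
by rewrite mem_primes lp x0 (dvdn_trans ld dx).
Qed.

(** Primes are removed from [d] one at a time; each is at most Y, so the quotients cannot jump over
    the interval (M, M Y]. *)
Lemma exists_smooth_divisor (M : R) (Y d : nat) : 1 <= M -> smooth_nat Y d ->
  M < d%:R -> exists m, [/\ (m %| d)%N, M < m%:R & m%:R <= M * Y%:R].
Proof.
move=> M1; have [b] := ubnP d; elim: b d => // b IHb d db sd Md.
have [dM|Mdl] := lerP d%:R (M * Y%:R); first by exists d; rewrite dvdnn.
have [d0 /allP sd'] := andP sd.
have d1 : (1 < d)%N by rewrite -(ltr_nat R) (le_lt_trans M1).
have pp := pdiv_prime d1; have dE := divnK (pdiv_dvd d).
have pY : (pdiv d <= Y)%N by rewrite sd' // mem_primes pp d0 pdiv_dvd.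
have d'd : (d %/ pdiv d %| d)%N by rewrite dvdn_div ?pdiv_dvd.
have [||m [md' Mm mM]] := IHb (d %/ pdiv d)%N _ (smooth_nat_dvd d'd sd).
- by rewrite (leq_trans _ (ltnSE db)) // ltn_Pdiv ?prime_gt1.
- rewrite -(ltr_pM2r (_ : 0 < (pdiv d)%:R)) ?ltr0n ?prime_gt0 //.
  rewrite -natrM dE; apply: le_lt_trans Mdl.
  by rewrite ler_wpM2l ?(le_trans _ M1) // ler_nat.
by exists m; split=> //; exact: dvdn_trans md' d'd.
Qed.

Lemma powR_ge1 (a r : R) : 1 <= a -> 0 <= r -> 1 <= a `^ r.
Proof. by move=> a1 r0; rewrite -(powRr0 a) ler_powR. Qed.

(** Primes l >= B satisfy c <= l^eps, and at most B primes are smaller. *)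
Lemma expr_omega_bound (c eps : R) : 1 <= c -> 0 < eps ->
  exists2 C, 1 <= C & forall n, (0 < n)%N ->
    c ^+ size (primes n) <= C * n%:R `^ eps.
Proof.
move=> c1 eps0; have c0 : 0 < c by exact: lt_le_trans c1.
pose B := (Num.truncn (c `^ eps^-1)).+1.
exists (c ^+ B); first by rewrite exprn_ege1.
move=> n n0.
have step (s : seq nat) : all (leq 1) s ->
    c ^+ size s <= c ^+ count (fun l => l < B)%N s * (\prod_(l <- s) l)%:R `^ eps.
  elim: s => [|l s IHs] /=; first by rewrite big_nil powR1 mulr1.
  move=> /andP[l0 /IHs {}IHs]; rewrite big_cons natrM powRM // exprD.
  rewrite mulrACA exprS ler_pM ?exprn_ge0 ?(ltW c0) //.
  case: ltnP => lB /=.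
    by rewrite expr1 ler_peMr ?(ltW c0) // powR_ge1 ?ler1n // ltW.
  rewrite expr0 mul1r -[c in c <= _]powRr1 ?(ltW c0) //.
  rewrite -[X in _ `^ X <= _](mulVf (lt0r_neq0 eps0)) powRrM.
  rewrite ge0_ler_powR ?nnegrE ?powR_ge0 ?(ltW eps0) //; apply: ltW.
  by apply: lt_le_trans (truncnS_gt _) _; rewrite ler_nat.
apply: le_trans (step _ _) _.
  by apply/allP => l; rewrite mem_primes => /andP[/prime_gt0].
apply: ler_pM; rewrite ?exprn_ge0 ?powR_ge0 ?(ltW c0) //.
  rewrite ler_weXn2l //.
  rewrite -size_filter -[X in (_ <= X)%N](size_iota 0).
  apply: uniq_leq_size; first by rewrite filter_uniq ?primes_uniq.
  by move=> l; rewrite mem_filter mem_iota => /andP[].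
rewrite ge0_ler_powR ?nnegrE ?ler_nat ?(ltW eps0) //.
rewrite [X in (_ <= X)%N]prod_prime_decomp // /primes big_map big_seq.
rewrite [X in (_ <= X)%N]big_seq; apply: leq_prod => -[l e].
move=> /mem_prime_decomp[/prime_gt0 l0 e0 _] /=.
by rewrite -[X in (X <= _)%N]expn1 leq_pexp2l.
Qed.

Definition supported (ps : seq nat) (e : nat) : bool := all (mem ps) (primes e).

Lemma count_supported_cons (p : nat) (ps : seq nat) (N : nat) : prime p ->
  (count (supported (p :: ps)) (iota 1 N) <=
   count (supported ps) (iota 1 N) +
   count (supported (p :: ps)) (iota 1 (N %/ p)))%N.
Proof.
move=> pp; rewrite -!size_filter.
rewrite -[size (seq.filter _ (iota 1 (N %/ p)))](size_map (muln p)) -size_cat.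
apply: uniq_leq_size; first by rewrite filter_uniq ?iota_uniq.
move=> e; rewrite mem_filter mem_iota add1n ltnS => /andP[/allP se /andP[e0 eN]].
rewrite mem_cat; apply/orP.
have [pe|npe] := boolP (p %| e)%N; last first.
  left; rewrite mem_filter mem_iota add1n ltnS e0 eN !andbT.
  apply/allP => l le; have := se l le; rewrite inE => /predU1P[lp|//].
  by move: le npe; rewrite lp mem_primes => /and3P[_ _ ->].
right; apply/mapP; exists (e %/ p)%N; last by rewrite muln_divA ?mulKn ?prime_gt0.
rewrite mem_filter mem_iota add1n ltnS leq_div2r // divn_gt0 ?prime_gt0 //.
rewrite dvdn_leq // !andbT; apply/allP => l.
rewrite mem_primes => /and3P[lp _ le]; apply: se.
by rewrite mem_primes lp e0 (dvdn_trans le) // dvdn_div.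
Qed.

(* The induction on N closes because 1 / K + p ^ - eps <= 1 for the chosen K. *)
Lemma count_supported_bound (eps : R) : 0 < eps ->
  exists2 K, 1 <= K & forall (ps : seq nat) (N : nat), all prime ps ->
    (count (supported ps) (iota 1 N))%:R <= K ^+ size ps * N%:R `^ eps.
Proof.
move=> eps0; pose t : R := 2 `^ (- eps).
have t0 : 0 < t by rewrite powR_gt0.
have t1 : t < 1.
  have e1 : 1 = 1 `^ eps :> R by rewrite powR1.
  rewrite /t powRN invf_lt1 ?powR_gt0 // [X in X < _]e1.
  by rewrite gt0_ltr_powR ?nnegrE ?ltr1n.
exists (1 - t)^-1; first by rewrite invf_ge1 ?subr_gt0 // gerBl ltW.
set K := (1 - t)^-1; have K0 : 0 < K by rewrite invr_gt0 subr_gt0.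
elim=> [|p ps IHps] N.
  move=> _; rewrite expr0 mul1r; case: N => [|N]; first by rewrite powR_ge0.
  apply: (@le_trans _ _ 1); last by rewrite powR_ge1 ?ler1n // ltW.
  rewrite lern1 -size_filter -[X in (_ <= X)%N]/(size [:: 1%N]).
  apply: uniq_leq_size; first by rewrite filter_uniq ?iota_uniq.
  move=> e; rewrite mem_filter mem_iota inE => /andP[se /andP[e0 _]].
  have pe : primes e == [::] by rewrite /supported in se; case: (primes e) se.
  by rewrite primes_eq0 in pe; apply/eqP; lia.
move=> /andP[pp pps]; have [b] := ubnP N; elim: b N => // b IHb N Nb.
case: (posnP N) => [->|N0]; first by rewrite mulr_ge0 ?exprn_ge0 ?powR_ge0 ?(ltW K0).
have p1 := prime_gt1 pp.
have Np : (N %/ p < N)%N by rewrite ltn_Pdiv.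
apply: (@le_trans _ _ (K ^+ size ps * N%:R `^ eps +
    K ^+ (size ps).+1 * (N %/ p)%:R `^ eps)).
  apply: le_trans (lerD (IHps N pps) (IHb (N %/ p)%N _)); last lia.
  by rewrite -natrD ler_nat count_supported_cons.
have le2 : (N %/ p)%:R `^ eps <= N%:R `^ eps * t.
  rewrite /t powRN ler_pdivlMr ?powR_gt0 // -powRM //.
  rewrite ge0_ler_powR ?nnegrE ?mulr_ge0 ?(ltW eps0) // -natrM ler_nat.
  by rewrite (leq_trans _ (leq_trunc_div N p)) // leq_mul2l p1 orbT.
apply: (@le_trans _ _ (K ^+ size ps * N%:R `^ eps +
    K ^+ (size ps).+1 * (N%:R `^ eps * t))).
  by rewrite lerD2l ler_wpM2l // exprn_ge0 // ltW.
rewrite le_eqVlt; apply/orP; left; apply/eqP => /=.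
rewrite exprS; have : K * (1 - t) = 1 by rewrite mulVf // subr_eq0 gt_eqF.
by move=> eK; rewrite -[X in X + _]mul1r -eK; ring.
Qed.

(** Each such x is its part prime to L, at most M, times an integer composed of primes of L. *)
Lemma count_bad_le (L M n : nat) :
  (count (fun x => partn x \pi(L)^' <= M)%N (iota 1 n) <=
   M * count (supported (primes L)) (iota 1 n))%N.
Proof.
rewrite -!size_filter -[X in (_ <= X * _)%N](size_iota 1) -(size_allpairs muln).
apply: uniq_leq_size; first by rewrite filter_uniq ?iota_uniq.
move=> x; rewrite mem_filter mem_iota add1n ltnS => /andP[xM /andP[x0 xn]].
apply/allpairsP; exists (partn x \pi(L)^', partn x \pi(L)); split=> /=.
- by rewrite mem_iota part_gt0 add1n ltnS.
- rewrite mem_filter mem_iota part_gt0 add1n ltnS /=; apply/andP; split.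
    by apply/allP => l; rewrite primes_part mem_filter => /andP[].
  by rewrite (leq_trans _ xn) // dvdn_leq // dvdn_part.
by rewrite mulnC partnC.
Qed.

(** In the application L is a derivative p'(z), and the x counted here are the only ones that can
    lack a divisor of size about M prime to L. They are few because L, polynomially bounded in n,
    has few prime factors. *)
Lemma bad_count_bound (k : nat) (eps : R) : 0 < eps ->
  exists2 C, 1 <= C & forall (n L : nat) (M : R), (0 < n)%N -> (0 < L)%N ->
    (L <= (k.+2 * n) ^ k)%N -> 0 <= M ->
    (count (fun x => (partn x \pi(L)^')%:R <= M) (iota 1 n))%:R <=
    C * M * n%:R `^ eps.
Proof.
move=> eps0; have eps20 : 0 < eps / 2 by rewrite divr_gt0.
have [K K1 Kb] := count_supported_bound eps20.
(* L^eps' is at most a constant times n^(k eps'), and k eps' <= eps / 2. *)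
pose eps' := eps / 2 / k.+1%:R.
have eps'0 : 0 < eps' by rewrite divr_gt0.
have [C C1 Cb] := expr_omega_bound K1 eps'0.
exists (C * (k.+2 ^ k)%:R `^ eps').
  by rewrite mulr_ege1 // powR_ge1 ?ler1n ?expn_gt0 // ltW.
move=> n L M n0 L0 Ln M0.
have -> : count (fun x => (partn x \pi(L)^')%:R <= M) (iota 1 n) =
    count (fun x => partn x \pi(L)^' <= Num.truncn M)%N (iota 1 n).
  by apply: eq_count => x; rewrite -truncn_ge_nat // num_real.
apply: (@le_trans _ _ (M * (K ^+ size (primes L) * n%:R `^ (eps / 2)))).
  apply: le_trans (_ : (Num.truncn M * count (supported (primes L)) (iota 1 n))%:R <= _).
    by rewrite ler_nat count_bad_le.
  rewrite natrM ler_pM ?truncn_le //; apply: Kb.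
  by apply/allP => l; rewrite mem_primes => /andP[].
have LE : K ^+ size (primes L) <= C * ((k.+2 ^ k)%:R `^ eps' * n%:R `^ (eps / 2)).
  apply: le_trans (Cb _ L0) _; rewrite ler_wpM2l // ?(le_trans _ C1) //.
  apply: (@le_trans _ _ (((k.+2 * n) ^ k)%:R `^ eps')).
    by rewrite ge0_ler_powR ?nnegrE ?ler_nat ?(ltW eps'0).
  rewrite ssrnat.expnMn natrM powRM // ler_wpM2l ?powR_ge0 //.
  rewrite natrX -powR_mulrn // -powRrM ler_powR ?ler1n // /eps'.
  rewrite mulrCA ler_piMr ?(ltW eps20) // ler_pdivrMr // mul1r ler_nat //.
have -> : C * (k.+2 ^ k)%:R `^ eps' * M * n%:R `^ eps =
    M * (C * ((k.+2 ^ k)%:R `^ eps' * n%:R `^ (eps / 2)) * n%:R `^ (eps / 2)).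
  have -> : n%:R `^ eps = n%:R `^ (eps / 2) * n%:R `^ (eps / 2) :> R.
    by rewrite -powRD -?splitr // pnatr_eq0 -lt0n n0 implybT.
  by ring.
by rewrite ler_wpM2l // ler_wpM2r ?powR_ge0.
Qed.

End SmoothDivisors.

(** * Efficient differencing *)

Section EnergySums.
Local Open Scope ring_scope.
Variable R : realType.

(** Cauchy-Schwarz over the common value, linearised as a c <= kap c^2 + a^2 / kap. It trades an
    asymmetric equation for two symmetric ones. *)
Lemma cross_le (X Y : finType) (D : pred X) (E : pred Y)
    (f : X -> nat) (g : Y -> nat) (kap : R) : 0 < kap ->
  (\sum_(x | D x) \sum_(y | E y) (f x == g y))%N%:R <=
  kap * (energy E g)%:R + kap^-1 * (energy D f)%:R.
Proof.
move=> k0; pose B := (\max_x f x + \max_y g y).+1.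
have fB x : D x -> (f x < B)%N.
  by move=> _; rewrite ltnS (leq_trans (leq_bigmax x)) ?leq_addr.
have gB y : E y -> (g y < B)%N.
  by move=> _; rewrite ltnS (leq_trans (leq_bigmax y)) ?leq_addl.
rewrite (cross_count _ _ fB) (energy_sq fB) (energy_sq gB).
rewrite !natr_sum !mulr_sumr -big_split /=; apply: ler_sum => v _.
rewrite natrM !natrX; set a := _%:R; set c := _%:R.
have -> : kap * c ^+ 2 + kap^-1 * a ^+ 2 =
    kap^-1 * ((kap * c - a) ^+ 2 + kap * (a * c) *+ 2).
  by field; rewrite gt_eqF.
rewrite mulrDr; apply: ler_wpDl.
  by apply: mulr_ge0; rewrite ?sqr_ge0 // invr_ge0 ltW.
rewrite -mulr_natl mulrCA mulKf ?gt_eqF //.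
by apply: ler_peMl; rewrite ?ler1n // mulr_ge0 ?ler0n.
Qed.

(** A pair is counted for v only if both members are bad at v; forgetting this for one of them still
    leaves at most b values of v per pair. *)
Lemma sum_energy_sub_le (X V : finType) (D : pred X) (S : pred V)
    (bad : X -> pred V) (f : X -> nat) (b : R) :
    (forall x, D x -> (\sum_(v | S v) bad x v)%N%:R <= b) ->
  (\sum_(v | S v) energy [pred x | D x && bad x v] f)%N%:R <=
  b * (energy D f)%:R.
Proof.
move=> Db; apply: (@le_trans _ _
   (\sum_(x | D x) \sum_(y | D y) (f x == f y) * \sum_(v | S v) bad x v)%N%:R).
  rewrite ler_nat /energy.
  under eq_bigr => v _ do rewrite big_mkcondr /=.
  rewrite exchange_big /=; apply: leq_sum => x Dx.
  apply: (@leq_trans (\sum_(v | S v) \sum_(y | D y) bad x v * (f x == f y))).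
    apply: leq_sum => v _; case: (bad x v) => //=.
    by rewrite big_mkcondr /=; apply: leq_sum => y _; rewrite mul1n; case: (bad y v).
  rewrite exchange_big /=; apply: leq_sum => y _.
  by rewrite -big_distrl /= mulnC.
rewrite /energy !natr_sum mulr_sumr; apply: ler_sum => x Dx.
rewrite !natr_sum mulr_sumr; apply: ler_sum => y Dy.
by rewrite natrM mulrC ler_wpM2r // Db.
Qed.

Lemma sum_energy_colour (X K : finType) (D : pred X) (f : X -> nat)
    (kap : X -> K) :
  (\sum_c energy [pred x | D x && (kap x == c)] f =
   \sum_(x | D x) \sum_(y | D y) ((f x == f y) && (kap x == kap y)))%N.
Proof.
rewrite /energy; under eq_bigr => c _ do rewrite big_mkcondr /=.
rewrite exchange_big /=; apply: eq_bigr => x Dx.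
rewrite (bigD1 (kap x)) //= eqxx [X in (_ + X)%N]big1 ?addn0 => [|c]; last first.
  by rewrite eq_sym => /negPf ->.
rewrite big_mkcondr /=; apply: eq_bigr => y Dy.
by rewrite [kap x == _]eq_sym; case: eqP; rewrite ?andbT ?andbF.
Qed.

Lemma energy_inj_le (X : finType) (D : pred X) (f : X -> nat) :
  {in D &, injective f} -> (energy D f <= #|D|)%N.
Proof.
move=> inj; rewrite /energy -sum1_card; apply: leq_sum => x Dx.
rewrite (bigD1 x) //= eqxx big1 // => y /andP[Dy yx].
by apply/eqP; rewrite eqb0; apply: contraNN yx => /eqP /inj ->.
Qed.

End EnergySums.

Section Differencing.
Local Open Scope ring_scope.
Variables (R : realType) (k : nat).

Definition smooth_le (n Y : nat) (Q : R) : pred 'I_n.+1 :=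
  [pred x : 'I_n.+1 | smooth_nat Y x && ((x : nat)%:R <= Q)].

Arguments smooth_le n Y Q : clear implicits.

Definition kth_power (n : nat) (x : 'I_n.+1) : nat := (x ^ k)%N.

Definition moment (s n Y : nat) (Q : R) : nat :=
  energy (ffun_dom (fun _ : 'I_s => smooth_le n Y Q))
    (ffun_sum (fun _ => @kth_power n)).

Definition positive_ord (n : nat) : pred 'I_n.+1 := [pred z : 'I_n.+1 | (0 < z)%N].

Definition eval_poly (n : nat) (p : {poly nat}) (z : 'I_n.+1) : nat := p.[z : nat].

(* The number of solutions of p.[z] + x_1 ^ k + ... + x_s ^ k =
   p.[w] + y_1 ^ k + ... + y_s ^ k with z, w in [1, n] and x_i, y_i smooth. *)
Definition diff_moment (s n Y : nat) (Q : R) (p : {poly nat}) : nat :=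
  mixed_energy (@positive_ord n) (eval_poly p)
    (fun _ : 'I_s => smooth_le n Y Q) (fun _ => @kth_power n).

Lemma card_ord_le (n : nat) (P : pred 'I_n.+1) (B : R) : 0 <= B ->
  (forall x : 'I_n.+1, P x -> (0 < x)%N /\ (x : nat)%:R <= B) -> #|P|%:R <= B.
Proof.
move=> B0 PB; rewrite -truncn_ge_nat // cardE -(size_map val).
rewrite -[X in (_ <= X)%N](size_iota 1); apply: uniq_leq_size.
  by rewrite map_inj_uniq ?enum_uniq //; exact: val_inj.
move=> _ /mapP[x xP ->]; move: xP; rewrite mem_enum => /PB[x0 xB].
by rewrite mem_iota add1n ltnS truncn_ge_nat // xB x0.
Qed.

Variables (s n Y : nat).

Section BadPart.
Variables (Q b kap : R) (p : {poly nat}) (bad : 'I_n.+1 -> pred 'I_n.+1).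
Hypotheses (Q0 : 0 <= Q) (b0 : 0 <= b) (kap0 : 0 < kap).
Hypothesis pinj : {in @positive_ord n &, injective (eval_poly p)}.
Hypothesis bad_le : forall z : 'I_n.+1, (0 < z)%N ->
  (\sum_(x | smooth_le n Y Q x) bad z x)%N%:R <= b.

(** Colouring by the value v of x_i, at most Q values, forces x_i = y_i = v. Then
    [mixed_energy_interp] restores the lost variable, and the sum over v costs only b because few v
    are bad for a given z. *)
Lemma bad_energy_le (i : 'I_s.+1) :
  (energy [pred q : 'I_n.+1 * {ffun 'I_s.+1 -> 'I_n.+1} |
     (@positive_ord n q.1 && ffun_dom (fun=> smooth_le n Y Q) q.2)
     && bad q.1 (q.2 i)]
     (fun q => eval_poly p q.1 + ffun_sum (fun=> @kth_power n) q.2)%N)%:R <=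
  Q * (b * (kap * (diff_moment s.+1 n Y Q p)%:R + kap^-1 ^+ s * n%:R)).
Proof.
set D := [pred q | _]; set f := (X in energy D X).
have DA q : D q -> smooth_le n Y Q (q.2 i).
  by case: q => z x /andP[/andP[_ /forallP Ex] _]; exact: Ex.
have := energy_colour f DA; rewrite -(ler_nat R) => le.
apply: le_trans le _.
rewrite natrM; apply: ler_pM => //.
  by apply: card_ord_le => // x /andP[/andP[x0 _] xQ].
pose Dv v := [pred z | @positive_ord n z && bad z v].
apply: (@le_trans _ _ (\sum_(v | smooth_le n Y Q v) (kap *
   (mixed_energy (Dv v) (eval_poly p) (fun _ : 'I_s.+1 => smooth_le n Y Q)
     (fun _ => @kth_power n))%:R + kap^-1 ^+ s * (energy (Dv v) (eval_poly p))%:R))).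
  rewrite natr_sum; apply: ler_sum => v Sv.
  apply: le_trans (mixed_energy_interp _ _ _ _ i v kap0); rewrite ler_nat.
  apply: energy_sub => -[z x] /andP[/andP[/andP[z0 /forallP Ex] bx] /eqP xv] /=.
  rewrite /Dv /= z0 -xv bx; apply/forallP => j.
  by case: eqP => [->|_] /=; [rewrite xv eqxx | exact: Ex].
rewrite big_split /= -!mulr_sumr mulrDr !(mulrCA b) lerD //.
  rewrite ler_wpM2l ?(ltW kap0) // -natr_sum.
  apply: le_trans (sum_energy_sub_le (bad := fun q => bad q.1) _ _).
    rewrite ler_nat; apply: leq_sum => v _; apply: energy_sub => -[z x] /=.
    by move=> /andP[/andP[-> ->] ->].
  by move=> [z x] /andP[z0 _]; exact: bad_le.
rewrite ler_wpM2l ?exprn_ge0 ?invr_ge0 ?(ltW kap0) // -natr_sum.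
apply: le_trans (sum_energy_sub_le (bad := bad) _ _) _; first exact: bad_le.
rewrite ler_wpM2l // ler_nat (leq_trans (energy_inj_le pinj)) //.
rewrite -(ler_nat R); apply: card_ord_le => // x x0; split=> //.
by rewrite ler_nat -ltnS.
Qed.

End BadPart.
End Differencing.

Arguments smooth_le {R} n Y Q _.
Arguments moment {R} k s n Y Q.
Arguments diff_moment {R} k s n Y Q p.

(** * Solutions in which every x_i has a suitable divisor *)

Section GoodPart.
Local Open Scope ring_scope.
Variables (R : realType) (k s n Y : nat) (p : {poly nat}).

(** The x_i stand for the original variables divided by m, whence the range Q / M where this count
    is applied. *)
Definition coprime_moment (m : nat) (Q : R) : nat :=
  mixed_energy [pred z : 'I_n.+1 | positive_ord z && coprime p^`().[z : nat] m]
    (eval_poly p) (fun _ : 'I_s => smooth_le n Y Q)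
    (fun _ (x : 'I_n.+1) => (m * x) ^ k)%N.

Definition medium_ord (M : R) : pred 'I_n.+1 :=
  [pred m : 'I_n.+1 | M < (m : nat)%:R <= M * Y%:R].

Lemma card_medium_ord (M : R) : 1 <= M -> #|medium_ord M|%:R <= M * Y%:R.
Proof.
move=> M1; apply: card_ord_le => [|m /andP[Mm mM]].
  by rewrite mulr_ge0 // (le_trans _ M1).
by split=> //; rewrite -(ltr_nat R) (le_lt_trans _ Mm) // (le_trans _ M1).
Qed.

Lemma exists_medium_divisor (M : R) (L : nat) (x : 'I_n.+1) : 1 <= M ->
    (0 < L)%N -> smooth_nat Y x -> M < (partn x \pi(L)^')%:R ->
  exists m : 'I_n.+1, [&& medium_ord M m, (m %| x)%N & coprime L m].
Proof.
move=> M1 L0 sx Mx; have [x0 _] := andP sx.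
have dx : (partn x \pi(L)^' %| x)%N by rewrite dvdn_part.
have [m [md Mm mM]] := exists_smooth_divisor M1 (smooth_nat_dvd dx sx) Mx.
have mx := dvdn_trans md dx.
have mn : (m < n.+1)%N by rewrite (leq_ltn_trans (dvdn_leq x0 mx)).
exists (Ordinal mn); rewrite /medium_ord /= Mm mM mx /=.
apply: coprime_prime_dvd => [|l lp lm]; first exact: dvdn_gt0 mx.
have : l \in \pi(partn x \pi(L)^').
  by rewrite mem_primes lp part_gt0 (dvdn_trans lm).
rewrite pi_of_part // => /andP[_]; apply: contra => lL.
by rewrite inE /= mem_primes lp L0.
Qed.

(** The colour is the tuple [mu] of divisors chosen for the x_i. Both the Cauchy-Schwarz factor and
    the number of tuples are at most (M Y)^s, whence the exponent 2 s; Hoelder's inequality then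
    reduces the tuple to a single m. *)
Lemma good_energy_le (Q M V : R) : 1 <= M -> 0 <= V ->
    (forall z : 'I_n.+1, (0 < z)%N -> (0 < p^`().[z : nat])%N) ->
    (forall m : 'I_n.+1, M < (m : nat)%:R ->
       (coprime_moment m (Q / M))%:R <= V) ->
  (0 < s)%N ->
  (energy [pred q : 'I_n.+1 * {ffun 'I_s -> 'I_n.+1} |
     (positive_ord q.1 && ffun_dom (fun=> smooth_le n Y Q) q.2) &&
     [forall i, M < (partn (q.2 i) \pi(p^`().[q.1 : nat])^')%:R]]
     (fun q => eval_poly p q.1 + ffun_sum (fun=> @kth_power k n) q.2)%N)%:R <=
  (M * Y%:R) ^+ (2 * s) * (s%:R * V).
Proof.
move=> M1 V0 L0 JV s0; have M0 : 0 < M by exact: lt_le_trans M1.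
set D := [pred q | _]; set f := (X in energy D X).
pose P (z x m : 'I_n.+1) := [&& medium_ord M m, (m %| x)%N & coprime p^`().[z : nat] m].
pose mp z x := odflt ord0 [pick m | P z x m].
have mpP z x : D (z, x) -> forall i, P z (x i) (mp z (x i)).
  move=> /andP[/andP[/= z0 /forallP Ax] /forallP gx] i.
  rewrite /mp; case: pickP => [//|no].
  have /andP[sx _] := Ax i.
  have [m] := exists_medium_divisor M1 (L0 z z0) sx (gx i).
  by rewrite -/(P z (x i) m) no.
pose S := [pred mu : {ffun 'I_s -> 'I_n.+1} | [forall i, medium_ord M (mu i)]].
pose kap (q : 'I_n.+1 * {ffun 'I_s -> 'I_n.+1}) := [ffun i => mp q.1 (q.2 i)].
have DS q : D q -> S (kap q).
  case: q => z x Dq; apply/forallP => i; rewrite ffunE.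
  by have /and3P[] := mpP _ _ Dq i.
have cS : #|S|%:R <= (M * Y%:R) ^+ s.
  have -> : #|S| = (#|medium_ord M| ^ s)%N.
    rewrite -[X in (_ ^ X)%N]card_ord -card_ffun_on; apply: eq_card => mu.
    by apply/forallP/ffun_onP.
  rewrite natrX lerXn2r ?nnegrE ?card_medium_ord //.
  by rewrite mulr_ge0 // ltW.
have := energy_colour f DS; rewrite -(ler_nat R) => le; apply: le_trans le _.
rewrite natrM mul2n -addnn exprD -mulrA ler_pM //.
apply: (@le_trans _ _ (#|S|%:R * (s%:R * V))); last first.
  by rewrite ler_wpM2r // mulr_ge0.
rewrite mulr_natl -sumr_const natr_sum; apply: ler_sum => mu.
move=> /forallP muM.
have mu0 i : (0 < mu i)%N.
  rewrite -(ltr_nat R); have /andP[Mm _] := muM i.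
  exact: lt_trans Mm.
apply: (@le_trans _ _ (mixed_energy
    [pred z : 'I_n.+1 | positive_ord z && [forall i, coprime p^`().[z : nat] (mu i)]]
    (eval_poly p) (fun _ : 'I_s => smooth_le n Y (Q / M))
    (fun i (x : 'I_n.+1) => (mu i * x) ^ k)%N)%:R).
  rewrite ler_nat.
  pose phi (q : 'I_n.+1 * {ffun 'I_s -> 'I_n.+1}) : 'I_n.+1 * {ffun 'I_s -> 'I_n.+1} :=
    (q.1, [ffun i => inord (q.2 i %/ mu i)]).
  have divE q i : D q && (kap q == mu) ->
      (inord (q.2 i %/ mu i) : 'I_n.+1) = (q.2 i %/ mu i)%N :> nat
      /\ (mu i * (q.2 i %/ mu i))%N = q.2 i.
    case: q => z x /andP[Dq /eqP <-]; rewrite ffunE /=; split.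
      by rewrite inordK // ltnS (leq_trans (leq_div _ _)) // -ltnS.
    by have /and3P[_ dv _] := mpP _ _ Dq i; rewrite mulnC divnK.
  apply: (@energy_inj _ _ _ _ _ _ phi).
  - move=> [z x] [z' x'] Dq Dq' [ez /ffunP ex]; congr (_, _) => //.
    apply/ffunP => i; apply: val_inj => /=.
    have := ex i; rewrite !ffunE => /(congr1 val) /=.
    have [/= -> d1] := divE _ i Dq; have [/= -> d2] := divE _ i Dq' => e.
    by rewrite -d1 -d2 e.
  - move=> [z x] Dq; have /andP[Dx /eqP ekap] := Dq.
    have /andP[/andP[/= z0 /forallP Ax] _] := Dx.
    rewrite /= z0 /=; apply/andP; split; apply/forallP => i.
      have /and3P[_ _] := mpP _ _ Dx i.
      by rewrite -ekap ffunE.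
    rewrite ffunE /smooth_le /= (divE _ i Dq).1 /=.
    have [_ ei] := divE _ i Dq; rewrite /= in ei.
    have /andP[sx xQ] := Ax i; apply/andP; split.
      by apply: smooth_nat_dvd sx; rewrite -{2}ei dvdn_mull.
    rewrite ler_pdivlMr // (le_trans _ xQ) // -[in leRHS]ei natrM mulrC.
    by rewrite ler_wpM2r // ltW //; have /andP[] := muM i.
  move=> q q' Dq Dq'; rewrite /f /= => e.
  suff ffE t : D t && (kap t == mu) ->
      ffun_sum (fun i (x : 'I_n.+1) => (mu i * x) ^ k)%N (phi t).2 =
      ffun_sum (fun=> @kth_power k n) t.2 by rewrite !ffE.
  move=> Dt; apply: eq_bigr => i _.
  by rewrite ffunE (divE _ i Dt).1 (divE _ i Dt).2.
have := mixed_energy_hoelder R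
  [pred z : 'I_n.+1 | positive_ord z && [forall i, coprime p^`().[z : nat] (mu i)]]
  (eval_poly p) (fun _ : 'I_s => smooth_le n Y (Q / M))
  (fun i (x : 'I_n.+1) => (mu i * x) ^ k)%N s0.
rewrite -(ler_nat R) => le2; apply: le_trans le2 _.
rewrite natr_sum mulr_natl -[X in _ *+ X]card_ord -sumr_const.
apply: ler_sum => i _; apply: le_trans (JV (mu i) _); last by case/andP: (muM i).
rewrite ler_nat; apply: energy_sub => -[z x] /andP[/andP[/= z0 /forallP cz] Ax].
by rewrite /= z0 cz.
Qed.

End GoodPart.

(** * The congruence modulo m^k and the modified difference *)

Section CongruencePart.
Local Open Scope ring_scope.
Variables (R : realType) (k s n Y : nat) (p : {poly nat}).

(** Colouring costs k for each prime of m and gives z = w modulo m^k. Solutions with z = w yield the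
    first term. In the others z and w differ by h m^k with at most n / m^k values of h; the 2
    accounts for the order of z and w. *)
Lemma coprime_moment_le (m : nat) (Q D1 kap : R) :
    (0 < k)%N -> (0 < m)%N -> (size p <= k.+1)%N -> 0 < kap -> 0 <= D1 ->
    (forall h, (0 < h)%N -> (h * m ^ k <= n)%N ->
       (diff_moment k s n Y Q (mod_diff k h m p))%:R <= D1) ->
  (coprime_moment k s n Y p m Q)%:R <=
  k%:R ^+ size (primes m) *
    (n%:R * (moment k s n Y Q)%:R +
     2 * (n%:R / m%:R ^+ k * (kap * (moment k s n Y Q)%:R + kap^-1 * D1))).
Proof.
move=> k0 m0 szp kap0 D10 D1P.
pose dom : pred {ffun 'I_s -> 'I_n.+1} := ffun_dom (fun=> smooth_le n Y Q).
pose S := @ffun_sum _ s (fun _ => @kth_power k n).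
pose f (q : 'I_n.+1 * {ffun 'I_s -> 'I_n.+1}) := (eval_poly p q.1 + m ^ k * S q.2)%N.
pose D := [pred q : 'I_n.+1 * {ffun 'I_s -> 'I_n.+1} | positive_ord q.1 && dom q.2].
pose D' := [pred q : 'I_n.+1 * {ffun 'I_s -> 'I_n.+1} |
  [pred z : 'I_n.+1 | positive_ord z && coprime p^`().[z : nat] m] q.1 && dom q.2].
pose H := [pred h : 'I_n.+1 | (0 < h)%N && (h * m ^ k <= n)%N].
(* This is 1 if z exceeds w by an admissible multiple of m^k and 0 otherwise. *)
pose step (z w : 'I_n.+1) := (\sum_(h | H h) (z == w + h * m ^ k :> nat))%N.
have mk0 : (0 < m ^ k)%N by rewrite expn_gt0 m0.
have SE u : ffun_sum (fun _ (x : 'I_n.+1) => (m * x) ^ k)%N u = (m ^ k * S u)%N.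
  by rewrite /ffun_sum big_distrr /=; apply: eq_bigr => i _; rewrite ssrnat.expnMn.
have -> : coprime_moment k s n Y p m Q = energy D' f.
  apply: eq_bigr => q _; apply: eq_bigr => q' _.
  by rewrite !SE.
have eq_mod q q' : f q = f q' ->
    p.[q.1 : nat] = p.[q'.1 : nat] %[mod m ^ k].
  move=> /(congr1 (fun x => x %% m ^ k)%N).
  by rewrite /f -modnDmr modnMr addn0 -[in RHS]modnDmr modnMr addn0.
have step1 : (\sum_c energy
    [pred q | D' q && (residue_colour k.-1 p m q.1 == c)] f <=
    \sum_(q | D q) \sum_(q' | D q') (f q == f q') *
       ((q.1 == q'.1) + (step q.1 q'.1 + step q'.1 q.1)))%N.
  rewrite sum_energy_colour.
  have D'D q : D' q -> D q by case/andP=> /andP[q0 _] dq; rewrite /D /= q0.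
  rewrite big_mkcond [leqRHS]big_mkcond /=; apply: leq_sum => q _.
  case: ifPn => // Dq; have /= -> := D'D q Dq.
  rewrite big_mkcond [leqRHS]big_mkcond /=.
  apply: leq_sum => q' _; case: ifPn => // Dq'; have /= -> := D'D q' Dq'.
  case: eqP => // efq; case: eqP => //= ecol; rewrite mul1n.
  have /andP[/andP[_ cz] _] := Dq; have /andP[/andP[_ cw] _] := Dq'.
  have emod : (q.1 : nat) = q'.1 %[mod m ^ k].
    by apply: (residue_colour_inj _ m0 k0 cz cw (eq_mod _ _ efq) ecol); rewrite prednK.
  have stepP (z w : 'I_n.+1) : (z : nat) = w %[mod m ^ k] -> (w < z)%N ->
      (0 < step z w)%N.
    move=> /eqP; case: ltngtP => // wz; rewrite eqn_mod_dvd ?(ltnW wz) // => /dvdnP[h eh] _.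
    have h0 : (0 < h)%N by case: h eh => //; lia.
    have hn : (h < n.+1)%N by have := ltn_ord z; nia.
    rewrite /step (bigD1 (Ordinal hn)) /=; last first.
      by rewrite h0 -eh; have := ltn_ord z; lia.
    by rewrite -eh subnKC ?(ltnW wz) // eqxx.
  case: (ltngtP q.1 q'.1) => [lt|lt|/val_inj ->]; last by rewrite eqxx.
    by rewrite addnA ltn_addl // stepP.
  by rewrite addnCA ltn_addr // stepP.
have := energy_colour f (fun q (_ : D' q) => isT : predT (residue_colour k.-1 p m q.1)).
rewrite -(ler_nat R) => le; apply: le_trans le _.
have -> : #|predT : pred {ffun 'I_(size (primes m)) -> 'I_k.-1.+1}| =
    (k ^ size (primes m))%N.
  by rewrite card_ffun !card_ord prednK.
rewrite natrM natrX ler_wpM2l ?exprn_ge0 //.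
pose mom := moment k s n Y Q.
(* As z is determined by w and h, the equation divided by m^k keeps a polynomial variable on one
   side only; [cross_le] makes it symmetric again. *)
pose cross h := (\sum_(t | D t) \sum_(v | dom v)
  (eval_poly (mod_diff k h m p) t.1 + S t.2 == S v))%N.
have pairD (F : 'I_n.+1 -> {ffun 'I_s -> 'I_n.+1} -> nat) :
    (\sum_(q | D q) F q.1 q.2 =
     \sum_(z | positive_ord z) \sum_(u | dom u) F z u)%N.
  by rewrite pair_big.
pose T1 := (\sum_(q | D q) \sum_(q' | D q') (f q == f q') * (q.1 == q'.1))%N.
pose T2 := (\sum_(q | D q) \sum_(q' | D q') (f q == f q') * step q.1 q'.1)%N.
have T1le : (T1 <= n * mom)%N.
  have -> : T1 = (\sum_(z : 'I_n.+1 | positive_ord z) mom)%N.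
    rewrite /T1; under eq_bigr => q _.
      rewrite (pairD (fun w v => (f q == f (w, v)) * (q.1 == w))%N) /=; over.
    rewrite (pairD (fun z u => \sum_(w | positive_ord w) \sum_(v | dom v)
      (f (z, u) == f (w, v)) * (z == w))%N).
    apply: eq_bigr => z z0; apply: eq_bigr => u du.
    rewrite (bigD1 z) //= [X in (_ + X)%N]big1 ?addn0 => [|w /andP[_ wz]]; last first.
      by apply: big1 => v _; rewrite [z == w]eq_sym (negPf wz) muln0.
    by apply: eq_bigr => v dv; rewrite eqxx muln1 /f /= eqn_add2l eqn_pmul2l.
  rewrite sum_nat_const leq_mul2r; apply/orP; right.
  rewrite -(ler_nat R); apply: card_ord_le => // x x0; split=> //.
  by rewrite ler_nat -ltnS.
have T2le : (T2 <= \sum_(h | H h) cross h)%N.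
  rewrite /T2; under eq_bigr do under eq_bigr do rewrite big_distrr /=.
  under eq_bigr do rewrite exchange_big /=.
  rewrite exchange_big /=; apply: leq_sum => h Hh.
  rewrite exchange_big /= (pairD (fun w v => \sum_(q | D q)
    (f q == f (w, v)) * (q.1 == w + h * m ^ k :> nat))%N).
  rewrite /cross (pairD (fun w u => \sum_(v | dom v)
    (eval_poly (mod_diff k h m p) w + S u == S v))%N).
  apply: leq_sum => w w0; rewrite [leqRHS]exchange_big /=; apply: leq_sum => v dv.
  rewrite (pairD (fun z u => (f (z, u) == f (w, v)) * (z == w + h * m ^ k :> nat))%N).
  rewrite exchange_big /=; apply: leq_sum => u du.
  apply: (@leq_trans (\sum_(z : 'I_n.+1 | positive_ord z)
      (eval_poly (mod_diff k h m p) w + S u == S v) * (z == w + h * m ^ k :> nat))%N).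
    apply: leq_sum => z z0.
    have [ez|_] := eqVneq (z : nat) (w + h * m ^ k)%N; last by rewrite !muln0.
    rewrite /f /= /eval_poly ez horner_mod_diff -addnA -mulnDr.
    by rewrite eqn_add2l eqn_pmul2l.
  rewrite -big_distrr /=; case: eqP => //= _; rewrite mul1n.
  case: (ltnP (w + h * m ^ k) n.+1) => [lt|ge]; last first.
    rewrite big1 // => z _; apply/eqP; rewrite eqb0; apply/eqP => ez.
    by have := ltn_ord z; rewrite ez ltnNge ge.
  apply: (@leq_trans (\sum_(z : 'I_n.+1) (z == Ordinal lt))%N).
    by rewrite big_mkcond /=; apply: leq_sum => z _; case: ifP.
  by rewrite (bigD1 (Ordinal lt)) //= eqxx big1 ?addn0 // => z /negPf ->.
have T12 : (\sum_(q | D q) \sum_(q' | D q') (f q == f q') *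
    ((q.1 == q'.1) + (step q.1 q'.1 + step q'.1 q.1)) = T1 + 2 * T2)%N.
  rewrite mul2n -addnn {2}/T2 [X in (_ + (_ + X))%N]exchange_big /T1 /T2 /=.
  rewrite -!big_split /=; apply: eq_bigr => q _.
  rewrite -!big_split /=; apply: eq_bigr => q' _.
  by rewrite !mulnDr [f q' == _]eq_sym.
rewrite T12 in step1.
apply: le_trans (_ : (n * mom + 2 * \sum_(h | H h) cross h)%N%:R <= _).
  by rewrite ler_nat (leq_trans step1) // leq_add // leq_mul2l T2le orbT.
rewrite natrD !natrM lerD2l ler_wpM2l // natr_sum.
apply: (@le_trans _ _ (\sum_(h | H h) (kap * mom%:R + kap^-1 * D1))).
  apply: ler_sum => h /andP[h0 hm].
  apply: le_trans (cross_le _ _ _ _ kap0) _; rewrite lerD2l ler_wpM2l //.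
    by rewrite invr_ge0 ltW.
  exact: D1P.
rewrite sumr_const -[leLHS]mulr_natl ler_wpM2r //.
  by rewrite addr_ge0 // mulr_ge0 ?invr_ge0 ?(ltW kap0).
apply: card_ord_le => [|h /andP[h0 hm]]; first by rewrite divr_ge0 ?exprn_ge0.
split=> //; rewrite ler_pdivlMr ?exprn_gt0 ?ltr0n //.
by rewrite -natrX -natrM ler_nat.
Qed.

End CongruencePart.

(** * One complete differencing step *)

Section DifferencingStep.
Local Open Scope ring_scope.
Variables (R : realType) (k s' n Y r : nat) (p : {poly nat}) (Q M b K D1 : R).
Local Notation s := s'.+1.
Local Notation dom := (ffun_dom (fun _ : 'I_s => smooth_le n Y Q)).
Local Notation c := (2 * (s.+1%:R * s%:R) : R).

Let bad (z x : 'I_n.+1) : bool := (partn x \pi(p^`().[z : nat])^')%:R <= M.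

Hypotheses (rk : (r < k)%N) (n0 : (0 < n)%N) (wp : weyl_poly k n r.+1 p).
Hypotheses (M1 : 1 <= M) (Q0 : 0 < Q) (b0 : 0 < b) (D10 : 0 <= D1).
Hypothesis bad_le : forall z : 'I_n.+1, (0 < z)%N ->
  (\sum_(x | smooth_le n Y Q x) bad z x)%N%:R <= b.
Hypothesis omega_le : forall m, (0 < m <= n)%N -> k%:R ^+ size (primes m) <= K.
Hypothesis diff_le : forall h m, (0 < h)%N -> (0 < m)%N -> (h * m ^ k <= n)%N ->
  (diff_moment k s n Y (Q / M) (mod_diff k h m p))%:R <= D1.

Lemma coprime_moment_medium (m : 'I_n.+1) : M < (m : nat)%:R ->
  (coprime_moment k s n Y p m (Q / M))%:R <=
  K * (n%:R * (3 * (moment k s n Y (Q / M))%:R + 2 * (D1 / M ^+ (2 * k)))).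
Proof.
move=> Mm; have M0 : 0 < M by exact: lt_le_trans M1.
have m0 : (0 < m)%N by rewrite -(ltr_nat R) (lt_trans M0).
have [k0 szp] : (0 < k)%N /\ (size p <= k.+1)%N.
  by split; [exact: leq_trans rk | exact: weyl_size wp].
have Mk : 0 < M ^+ k by rewrite exprn_gt0.
(* With kap = M^k and at most n / M^k shifts h, the moment enters the off-diagonal part with the
   factor n, as in the diagonal part. *)
apply: le_trans (coprime_moment_le k0 m0 szp Mk D10 _) _ => [h h0|].
  exact: diff_le.
apply: ler_pM; rewrite ?exprn_ge0 ?omega_le ?m0 //=.
- rewrite addr_ge0 ?mulr_ge0 ?divr_ge0 ?addr_ge0 ?exprn_ge0 //.
  + by rewrite mulr_ge0 // ltW.
  + by rewrite mulr_ge0 // invr_ge0 ltW.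
- by rewrite -ltnS.
set mo := (moment _ _ _ _ _)%:R.
have mo0 : 0 <= mo by rewrite /mo.
apply: (@le_trans _ _ (n%:R * mo + 2 * (n%:R / M ^+ k *
    (M ^+ k * mo + (M ^+ k)^-1 * D1)))).
  rewrite lerD2l ler_wpM2l // ler_wpM2r //.
    by rewrite addr_ge0 // mulr_ge0 ?invr_ge0 // ltW.
  rewrite ler_wpM2l // lef_pV2 ?posrE ?exprn_gt0 ?ltr0n //.
  by apply: lerXn2r; rewrite ?nnegrE ?(ltW M0) ?ler0n ?(ltW Mm).
rewrite mul2n -addnn exprD le_eqVlt; apply/orP; left; apply/eqP.
by move: (M ^+ k) Mk => X X0; field; rewrite gt_eqF.
Qed.

Lemma diff_moment_step :
  (diff_moment k s n Y Q p)%:R <=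
  c * ((M * Y%:R) ^+ (2 * s) * (K * (n%:R *
    (3 * (moment k s n Y (Q / M))%:R + 2 * (D1 / M ^+ (2 * k)))))) +
  n%:R * (c * (Q * b)) ^+ s.
Proof.
set dm := diff_moment _ _ _ _ _ _; set V := K * _.
have M0 : 0 < M by exact: lt_le_trans M1.
have c0 : 0 < c by rewrite !mulr_gt0 ?ltr0n.
have K0 : 0 <= K by apply: le_trans (@omega_le 1 _); rewrite ?exprn_ge0 ?n0.
have V0 : 0 <= V.
  rewrite mulr_ge0 // mulr_ge0 // addr_ge0 ?mulr_ge0 //.
  by rewrite invr_ge0 exprn_ge0 // ltW.
(* This weight makes the solutions without a coprime divisor contribute at
   most half of dm, plus a term that does not involve dm. *)
pose kap : R := (c * (Q * b))^-1.
have cQb0 : 0 < c * (Q * b) by rewrite !mulr_gt0 ?ltr0n.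
have kap0 : 0 < kap by rewrite invr_gt0.
pose f (q : 'I_n.+1 * {ffun 'I_s -> 'I_n.+1}) :=
  (eval_poly p q.1 + ffun_sum (fun=> @kth_power k n) q.2)%N.
pose D := [pred q : 'I_n.+1 * {ffun 'I_s -> 'I_n.+1} | positive_ord q.1 && dom q.2].
(* Colour 0 means that no x_i is bad, colour i + 1 that x_i is bad. *)
pose col (q : 'I_n.+1 * {ffun 'I_s -> 'I_n.+1}) : 'I_s.+1 :=
  if [pick i | bad q.1 (q.2 i)] is Some i then lift ord0 i else ord0.
have le1 : dm%:R <= s.+1%:R * (\sum_c0 energy [pred q | D q && (col q == c0)] f)%N%:R :> R.
  have := energy_colour f (fun q (_ : D q) => isT : predT (col q)).
  by rewrite -natrM ler_nat card_ord.
rewrite big_ord_recl natrD in le1.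
have good_le : (energy [pred q | D q && (col q == ord0)] f)%:R <=
    (M * Y%:R) ^+ (2 * s) * (s%:R * V).
  have pos (z : 'I_n.+1) : (0 < nat_of_ord z)%N -> (0 < p^`().[nat_of_ord z])%N :=
    fun z0 => weyl_deriv_gt0 wp z0.
  have := good_energy_le M1 V0 pos coprime_moment_medium isT.
  apply: le_trans.
  rewrite ler_nat; apply: energy_sub => -[z x] /andP[Dq]; rewrite /col.
  case: pickP => [i _|no _]; first by rewrite eq_sym (negPf (neq_lift _ _)).
  move: Dq; rewrite /D /= => -> /=; apply/forallP => i.
  by have := no i; rewrite /bad /= leNgt => /negbT; rewrite negbK.
have pinj : {in @positive_ord n &, injective (eval_poly p)}.
  by move=> z w z0 w0 e; apply/val_inj; apply: (weyl_horner_inj wp).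
have bad_le' (i : 'I_s) : (energy [pred q | D q && (col q == lift ord0 i)] f)%:R <=
    Q * (b * (kap * dm%:R + kap^-1 ^+ s' * n%:R)).
  have := bad_energy_le k (ltW Q0) (ltW b0) kap0 pinj bad_le i.
  apply: le_trans; rewrite ler_nat; apply: energy_sub => -[z x] /andP[Dq].
  rewrite /col; case: pickP => [j bj|_]; last by rewrite (negPf (neq_lift _ _)).
  move=> /eqP /lift_inj <-; move: Dq; rewrite /D /= => -> /=.
  exact: bj.
have le2 : dm%:R <= s.+1%:R * ((M * Y%:R) ^+ (2 * s) * (s%:R * V) +
    s%:R * (Q * (b * (kap * dm%:R + kap^-1 ^+ s' * n%:R)))).
  apply: le_trans le1 _; rewrite ler_wpM2l // lerD //.
  set W := Q * _; have -> : s%:R * W = \sum_(i < s) W.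
    by rewrite sumr_const card_ord mulr_natl.
  by rewrite natr_sum; apply: ler_sum => i _; exact: bad_le'.
have ekap : c * (Q * b) * kap = 1 by rewrite mulfV // gt_eqF.
move: le2; rewrite {2}/kap invrK exprS.
set B := (M * _) ^+ _; set E := (_ * (Q * b)) ^+ s'; set d : R := dm%:R.
have -> : s.+1%:R * (B * (s%:R * V) + s%:R * (Q * (b * (kap * d + E * n%:R)))) =
  2^-1 * (c * (B * V) + (c * (Q * b) * kap) * d + c * (Q * b) * E * n%:R).
  by field.
rewrite ekap => le2.
have -> : n%:R * (c * (Q * b) * E) = c * (Q * b) * E * n%:R by rewrite mulrC.
by lra.
Qed.

End DifferencingStep.

(** * Iteration of the exponents *)

Section LevelInduction.
Local Open Scope ring_scope.
Variable R : realType.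

Lemma powR_gt0D (x a b : R) : 0 < x -> x `^ (a + b) = x `^ a * x `^ b.
Proof. by move=> x0; rewrite powRD //; apply/implyP => _; rewrite gt_eqF. Qed.

(** Since Y >= 2, constants can be traded for powers of Y; therefore the two notions of exponent
    below carry no constant. *)
Lemma le_expr_uniform (x : R) :
  exists e : nat, forall Y : nat, (2 <= Y)%N -> x <= Y%:R ^+ e.
Proof.
exists (Num.truncn x).+1 => Y Y2; apply: ltW.
apply: lt_le_trans (truncnS_gt x) _; rewrite -natrX ler_nat.
by rewrite ltnW // ltn_expl.
Qed.

Lemma sum_ord_le_count (n : nat) (S : pred 'I_n.+1) (P : pred nat) :
    (forall x : 'I_n.+1, S x -> (0 < x)%N) ->
  (\sum_(x | S x) P x <= count P (iota 1 n))%N.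
Proof.
move=> S0; have -> : (\sum_(x | S x) P x = #|[pred x | S x && P x]|)%N.
  by rewrite -sum1_card [RHS]big_mkcondr; apply: eq_bigr => x _; case: (P x).
rewrite cardE -(size_map val) -size_filter; apply: uniq_leq_size.
  by rewrite map_inj_uniq ?enum_uniq //; exact: val_inj.
move=> y /mapP[x xP ->]; move: xP; rewrite mem_enum => /andP[/S0 x0 Px].
by rewrite mem_filter Px mem_iota add1n x0 /=.
Qed.

(** Losses are measured by Y and n, the main term by Q: differencing shrinks Q while n stays
    fixed. *)
Definition moment_exponent (k s : nat) (lam : R) : Prop :=
  forall eps : R, 0 < eps -> exists a : nat, forall (n Y : nat) (Q : R),
    (0 < n)%N -> (2 <= Y)%N -> 1 <= Q -> Q <= n%:R ->
    (moment k s n Y Q)%:R <= Y%:R ^+ a * n%:R `^ eps * Q `^ lam.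

(* Here r differencing steps remain; each divides Q by at most n ^ (1 / k), so
   the lower bound on Q keeps it at least as large as every modulus used. *)
Definition level_exponent (k s : nat) (lam : R) (r : nat) (xi : R) : Prop :=
  forall eps : R, 0 < eps -> exists a : nat,
  forall (n Y : nat) (Q : R) (p : {poly nat}),
    (0 < n)%N -> (2 <= Y)%N -> n%:R `^ (r%:R / k%:R) <= Q -> Q <= n%:R ->
    weyl_poly k n r p ->
    (diff_moment k s n Y Q p)%:R <=
    Y%:R ^+ a * n%:R `^ eps * (n%:R * Q `^ lam * n%:R `^ xi).

Lemma card_positive_ord (n : nat) : (#|@positive_ord n| <= n)%N.
Proof.
rewrite -(ler_nat R); apply: card_ord_le => // x x0; split=> //.
by rewrite ler_nat -ltnS.
Qed.

(** Cauchy-Schwarz makes z common to both sides, and then z is summed over. Compared with the factor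
    n in [level_exponent], the loss n^2 means xi = 1, the start of the recursion. *)
Lemma diff_moment_trivial (k s n Y : nat) (Q : R) (p : {poly nat}) :
  (diff_moment k s n Y Q p <= n * (n * moment k s n Y Q))%N.
Proof.
pose D := [pred q : 'I_n.+1 * {ffun 'I_s -> 'I_n.+1} |
  positive_ord q.1 && ffun_dom (fun=> smooth_le n Y Q) q.2].
have DS q : D q -> positive_ord q.1 by case/andP.
apply: leq_trans (energy_colour _ DS) _.
apply: leq_mul; first exact: card_positive_ord.
apply: (@leq_trans (\sum_(z | @positive_ord n z) moment k s n Y Q)).
  apply: leq_sum => z z0; apply: (@energy_inj _ _ _ _ _ _ snd).
  - by move=> [a u] [b v] /andP[_ /eqP /= ->] /andP[_ /eqP /= ->] /= ->.
  - by move=> [a u] /andP[/andP[_ Du] _].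
  - move=> [a u] [b v] /andP[_ /eqP /= ->] /andP[_ /eqP /= ->] /=.
    by move=> /eqP; rewrite eqn_add2l => /eqP.
by rewrite sum_nat_const leq_mul2r card_positive_ord orbT.
Qed.

Lemma level_exponent0 (k s : nat) (lam : R) :
  moment_exponent k s lam -> level_exponent k s lam 0 1.
Proof.
move=> adm eps eps0; have [a aP] := adm eps eps0; exists a => n Y Q p n0 Y2.
rewrite mul0r powRr0 => Q1 Qn _.
apply: le_trans (_ : (n * (n * moment k s n Y Q))%N%:R <= _).
  by rewrite ler_nat diff_moment_trivial.
rewrite !natrM powRr1 //.
have := aP n Y Q n0 Y2 Q1 Qn; set A := _ * _ `^ eps; set q := Q `^ lam => le.
have -> : A * (n%:R * q * n%:R) = n%:R * (n%:R * (A * q)) by ring.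
by rewrite !ler_wpM2l.
Qed.

(** Extracting divisors of size M costs M^(2 s) and gains M^lam, a net loss of M^nu with nu = 2 s -
    lam. For M = n^phi the new exponent is nu phi. *)
Lemma level_exponentS (k s r : nat) (lam xi : R) :
    (0 < s)%N -> (r < k)%N -> s%:R <= lam -> lam <= 2 * s%:R ->
    0 <= xi <= 1 ->
    moment_exponent k s lam -> level_exponent k s lam r xi ->
  level_exponent k s lam r.+1 ((2 * s%:R - lam) * (1 + xi) / (2 * k%:R)).
Proof.
case: s => // s' _ rk s_lam lam_s /andP[xi0 xi1] adm lev eps eps0.
set s := s'.+1 in s_lam lam_s adm lev *.
have k0 : (0 < k)%N by exact: leq_ltn_trans rk.
have kR : 0 < k%:R :> R by rewrite ltr0n.
(* The terms to be bounded contain 2 or s factors n^e1; s + 2 covers both cases. *)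
pose e1 := eps / s.+2%:R; have e10 : 0 < e1 by rewrite divr_gt0.
have [a0 a0P] := adm e1 e10; have [a1 a1P] := lev e1 e10.
have [Cb Cb1 CbP] := bad_count_bound k e10.
have [Cw Cw1 CwP] : exists2 C : R, 1 <= C & forall n, (0 < n)%N ->
    k%:R ^+ size (primes n) <= C * n%:R `^ e1.
  by apply: expr_omega_bound; rewrite ?ler1n.
pose c : R := 2 * (s.+1%:R * s%:R).
have c0 : 0 < c by rewrite !mulr_gt0 ?ltr0n.
have [b1 b1P] := le_expr_uniform (5 * c * Cw).
have [b2 b2P] := le_expr_uniform ((c * Cb) ^+ s).
(* Here [b1] and [b2] absorb the constants of the two terms of [diff_moment_step], a0 + a1 + 2 s the
   powers of Y in the first, and the successor the addition of both. *)
exists (b1 + (a0 + a1 + 2 * s) + b2).+1 => n Y Q p n0 Y2 nQ Qn wp.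
have nR : 0 < n%:R :> R by rewrite ltr0n.
have n1 : 1 <= n%:R :> R by rewrite ler1n.
have Y1 : 1 <= Y%:R :> R by rewrite ler1n ltnW.
(* This phi solves M^(2 k) = n^(1 + xi), which balances the two terms of [coprime_moment_medium]. As
   xi <= 1, M does not exceed n^(1 / k). *)
pose phi := (1 + xi) / (2 * k%:R); pose M := n%:R `^ phi.
have phi0 : 0 <= phi by rewrite divr_ge0 ?addr_ge0 // mulr_ge0.
have phik : phi <= k%:R^-1.
  by rewrite /phi ler_pdivrMr ?mulr_gt0 // mulrCA mulVf ?gt_eqF // mulr1; lra.
have M1 : 1 <= M by exact: powR_ge1.
have M0 : 0 < M by exact: lt_le_trans M1.
have Q0 : 0 < Q by apply: lt_le_trans nQ; rewrite powR_gt0.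
have nQM : n%:R `^ (r%:R / k%:R) <= Q / M.
  rewrite ler_pdivlMr //; apply: le_trans nQ; rewrite /M -powR_gt0D //.
  by rewrite ler_powR // -natr1 mulrDl mul1r lerD2l.
have QM1 : 1 <= Q / M by rewrite (le_trans _ nQM) // powR_ge1 // divr_ge0.
have QMn : Q / M <= n%:R.
  by rewrite ler_pdivrMr // (le_trans Qn) // ler_peMr.
have M2k : M ^+ (2 * k) = n%:R * n%:R `^ xi.
  rewrite /M -powR_mulrn ?powR_ge0 // -powRrM.
  rewrite -[X in X * _ `^ xi](@powRr1 R) // -powR_gt0D //; congr (_ `^ _).
  by rewrite /phi natrM; field; rewrite gt_eqF.
set nu := 2 * s%:R - lam; pose xi' := nu * (1 + xi) / (2 * k%:R).
pose A := (Q / M) `^ lam; have A0 : 0 <= A by exact: powR_ge0.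
pose ne := n%:R `^ e1; have ne1 : 1 <= ne by rewrite powR_ge1 // ltW.
have ne0 : 0 < ne by exact: lt_le_trans ne1.
pose D1 := Y%:R ^+ a1 * ne * (n%:R * A * n%:R `^ xi).
have D10 : 0 <= D1 by rewrite !mulr_ge0 ?exprn_ge0 ?powR_ge0 // ltW.
have K0 : 0 < Cw * ne by rewrite mulr_gt0 // (lt_le_trans ltr01).
have Cw0 : 0 <= Cw by exact: le_trans Cw1.
have Cb0 : 0 <= Cb by exact: le_trans Cb1.
have cc0 := ltW c0.
have b0 : 0 < Cb * M * ne by rewrite !mulr_gt0 // (lt_le_trans ltr01).
have bad_le (z : 'I_n.+1) : (0 < z)%N -> (\sum_(x | smooth_le n Y Q x)
    ((partn x \pi(p^`().[z : nat])^')%:R <= M)%R)%N%:R <= Cb * M * ne.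
  move=> z0; have zn : (z <= n)%N by rewrite -ltnS.
  apply: le_trans (CbP n p^`().[z : nat] M n0 _ _ (ltW M0)).
  - rewrite ler_nat; apply: (@sum_ord_le_count _ _
      (fun x => (partn x \pi(p^`().[z : nat])^')%:R <= M)) => x.
    by case/andP => /andP[].
  - exact: weyl_deriv_gt0 wp z0.
  - exact: weyl_deriv_le wp n0 zn.
have omega_le m : (0 < m <= n)%N -> k%:R ^+ size (primes m) <= Cw * ne.
  move=> /andP[m0 mn]; apply: le_trans (CwP m m0) _.
  rewrite ler_wpM2l ?(le_trans ler01) // ge0_ler_powR ?nnegrE ?ler_nat //.
  exact: ltW.
have diff_le h m : (0 < h)%N -> (0 < m)%N -> (h * m ^ k <= n)%N ->
    (diff_moment k s n Y (Q / M) (mod_diff k h m p))%:R <= D1.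
  move=> h0 m0 hm; apply: a1P => //.
  exact: weyl_mod_diff.
have := diff_moment_step rk n0 wp M1 Q0 b0 D10 bad_le omega_le diff_le.
move/le_trans; apply.
pose G := Q `^ lam * n%:R `^ xi'.
have G0 : 0 <= G by rewrite mulr_ge0 ?powR_ge0.
have Mnu : M `^ nu = n%:R `^ xi'.
  by rewrite /M -powRrM; congr (_ `^ _); rewrite /xi' /phi; ring.
have QA : A * M `^ lam = Q `^ lam.
  by rewrite /A -powRM ?divr_ge0 ?(ltW M0) ?(ltW Q0) // divfK ?gt_eqF.
have MG : M ^+ (2 * s) * A = G.
  rewrite /G -QA -Mnu -mulrA -powR_gt0D // mulrC -powR_mulrn ?(ltW M0) //.
  by congr (_ * _ `^ _); rewrite /nu natrM; ring.
(* The exceptional solutions are no larger than the main term because lam >= s and Q >= M. *)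
have QMG : (Q * M) ^+ s <= G.
  rewrite -MG /A.
  have -> : (Q / M) `^ lam = (Q / M) ^+ s * (Q / M) `^ (lam - s%:R).
    rewrite -powR_mulrn ?(le_trans ler01) // -powR_gt0D ?(lt_le_trans ltr01) //.
    by congr (_ `^ _); ring.
  have -> : (Q * M) ^+ s = M ^+ (2 * s) * (Q / M) ^+ s.
    by rewrite exprM -exprMn; congr (_ ^+ _); field; rewrite gt_eqF.
  rewrite mulrA ler_peMr ?powR_ge1 ?subr_ge0 //.
  by rewrite mulr_ge0 ?exprn_ge0 ?divr_ge0 ?(ltW M0) ?(ltW Q0).
have neX j : (j <= s.+2)%N -> ne ^+ j <= n%:R `^ eps.
  move=> js; rewrite /ne -powR_mulrn ?powR_ge0 // -powRrM ler_powR //.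
  by rewrite /e1 mulrAC ler_pdivrMr ?ltr0n // ler_wpM2l ?(ltW eps0) // ler_nat.
have momP := a0P n Y (Q / M) n0 Y2 QM1 QMn; rewrite -/ne -/A in momP.
have D1E : D1 / M ^+ (2 * k) = Y%:R ^+ a1 * ne * A.
  have xi_n0 : 0 < n%:R `^ xi :> R by exact: powR_gt0.
  by rewrite M2k /D1; field; rewrite ?gt_eqF.
rewrite D1E; set y : R := Y%:R in Y1 momP *.
have y0 : 0 <= y by exact: le_trans Y1.
have yX i j : (i <= j)%N -> y ^+ i <= y ^+ j by move=> ij; rewrite ler_weXn2l.
have yX0 i : 0 <= y ^+ i by exact: exprn_ge0.
have first_le : c * ((M * y) ^+ (2 * s) * (Cw * ne * (n%:R *
    (3 * (moment k s n Y (Q / M))%:R + 2 * (y ^+ a1 * ne * A))))) <=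
    y ^+ (b1 + (a0 + a1 + 2 * s)) * (n%:R `^ eps * (n%:R * G)).
  apply: (@le_trans _ _ (c * ((M * y) ^+ (2 * s) * (Cw * ne * (n%:R *
      (3 * (y ^+ a0 * ne * A) + 2 * (y ^+ a1 * ne * A))))))).
    rewrite ler_wpM2l ?(ltW c0) // ler_wpM2l ?exprn_ge0 ?mulr_ge0 ?(ltW M0) //.
    by rewrite ler_wpM2l ?(ltW K0) // ler_wpM2l ?(ltW nR) // lerD2r ler_wpM2l.
  have -> : c * ((M * y) ^+ (2 * s) * (Cw * ne * (n%:R *
      (3 * (y ^+ a0 * ne * A) + 2 * (y ^+ a1 * ne * A))))) =
      c * Cw * (3 * y ^+ a0 + 2 * y ^+ a1) * y ^+ (2 * s) * (ne ^+ 2 * (n%:R * (M ^+ (2 * s) * A))).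
    by rewrite exprMn; ring.
  rewrite MG; apply: ler_pM.
  - rewrite mulr_ge0 // mulr_ge0 ?addr_ge0 //; do ?exact: mulr_ge0.
  - by rewrite mulr_ge0 ?exprn_ge0 ?(ltW ne0) // mulr_ge0.
  - have le5 : 3 * y ^+ a0 + 2 * y ^+ a1 <= 5 * y ^+ (a0 + a1).
      have -> : 5 = 3 + 2 :> R by ring.
      rewrite [leRHS]mulrDl lerD // ler_wpM2l // yX //.
        exact: leq_addr.
      exact: leq_addl.
    apply: (@le_trans _ _ ((5 * c * Cw) * (y ^+ (a0 + a1) * y ^+ (2 * s)))).
      have -> : 5 * c * Cw * (y ^+ (a0 + a1) * y ^+ (2 * s)) =
        c * Cw * (5 * y ^+ (a0 + a1)) * y ^+ (2 * s) by ring.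
      by rewrite ler_wpM2r // ler_wpM2l // mulr_ge0.
    by rewrite [leRHS]exprD [y ^+ (a0 + a1 + _)]exprD ler_wpM2r ?mulr_ge0 ?b1P.
  by rewrite ler_wpM2r ?neX // mulr_ge0.
have second_le : n%:R * (c * (Q * (Cb * M * ne))) ^+ s <=
    y ^+ b2 * (n%:R `^ eps * (n%:R * G)).
  have -> : n%:R * (c * (Q * (Cb * M * ne))) ^+ s =
      (c * Cb) ^+ s * (ne ^+ s * (n%:R * (Q * M) ^+ s)).
    by rewrite !exprMn; ring.
  have QM0 : 0 <= (Q * M) ^+ s by rewrite exprn_ge0 // mulr_ge0 ?(ltW Q0) ?(ltW M0).
  apply: ler_pM; rewrite ?b2P //.
  - by rewrite exprn_ge0 // mulr_ge0.
  - by rewrite mulr_ge0 ?exprn_ge0 ?(ltW ne0) // mulr_ge0.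
  apply: ler_pM.
  - by rewrite exprn_ge0 ?(ltW ne0).
  - by rewrite mulr_ge0.
  - by rewrite neX // leqW.
  by rewrite ler_wpM2l.
apply: le_trans (lerD first_le second_le) _.
rewrite -mulrDl -[n%:R * _ * _]mulrA -/G -[leRHS]mulrA.
rewrite ler_wpM2r ?mulr_ge0 ?powR_ge0 //.
set e := (b1 + (a0 + a1 + 2 * s))%N.
have y2 : 2 <= y by rewrite /y (ler_nat R 2).
have le2 : 2 * y ^+ (e + b2) <= y ^+ (e + b2).+1 by rewrite exprS ler_wpM2r.
apply: le_trans le2; rewrite mulr_natl mulr2n.
by rewrite lerD // yX ?leq_addr ?leq_addl.
Qed.

End LevelInduction.

(** * From s to s + 1 variables *)

Section MomentIteration.
Local Open Scope ring_scope.
Variables (R : realType) (k : nat).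
Hypothesis k0 : (0 < k)%N.

Let kR : 0 < k%:R :> R. Proof. by rewrite ltr0n. Qed.

Lemma moment_exponent_le (s : nat) (lam lam' : R) :
  lam <= lam' -> moment_exponent k s lam -> moment_exponent k s lam'.
Proof.
move=> le adm eps eps0; have [a aP] := adm eps eps0; exists a => n Y Q n0 Y2 Q1 Qn.
apply: le_trans (aP n Y Q n0 Y2 Q1 Qn) _.
by rewrite ler_wpM2l ?ler_powR // mulr_ge0 ?exprn_ge0 ?powR_ge0.
Qed.

Lemma smooth_le_gt0 (n Y : nat) (Q : R) (x : 'I_n.+1) :
  smooth_le n Y Q x -> (0 < x)%N.
Proof. by case/andP => /andP[]. Qed.

Lemma moment_exponent1 : moment_exponent k 1 (1 : R).
Proof.
move=> eps eps0; exists 0%N => n Y Q n0 Y2 Q1 Qn.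
have Q0 : 0 <= Q by exact: le_trans Q1.
rewrite expr0 mul1r powRr1 //.
apply: (@le_trans _ _ Q); last by rewrite ler_peMl // powR_ge1 ?ler1n // ltW.
apply: (@le_trans _ _ #|smooth_le n Y Q|%:R); last first.
  by apply: card_ord_le => // x Sx; rewrite (smooth_le_gt0 Sx); case/andP: Sx.
rewrite ler_nat; apply: (@leq_trans (energy (smooth_le n Y Q) (@kth_power k n))).
  apply: (@energy_inj _ _ _ _ _ _ (fun u : {ffun 'I_1 -> 'I_n.+1} => u ord0)).
  - by move=> u v _ _ e; apply/ffunP => i; rewrite ord1.
  - by move=> u /forallP Su; exact: Su.
  - by move=> u v _ _; rewrite /ffun_sum !big_ord1.
apply: energy_inj_le => x y _ _ /eqP; rewrite eqn_exp2r // => /eqP e.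
exact: val_inj.
Qed.

(** At level k the hypotheses of [level_exponent] force Q = n, so the ambient range is first cut
    down to the integer part of Q. *)
Lemma moment_truncn (s n Y : nat) (Q : R) : 1 <= Q -> Q <= n%:R ->
  (moment k s n Y Q <=
   moment k s (Num.truncn Q) Y ((Num.truncn Q)%:R : R))%N.
Proof.
move=> Q1 Qn; set n' := Num.truncn Q.
have Q0 : 0 <= Q by exact: le_trans Q1.
have le_n' (x : 'I_n.+1) : smooth_le n Y Q x -> (x < n'.+1)%N.
  by move=> /andP[_ xQ]; rewrite ltnS truncn_ge_nat.
pose phi (u : {ffun 'I_s -> 'I_n.+1}) : {ffun 'I_s -> 'I_n'.+1} :=
  [ffun i => inord (u i)].
have phiE u i : ffun_dom (fun _ : 'I_s => smooth_le n Y Q) u ->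
    phi u i = u i :> nat.
  by move=> /forallP Su; rewrite ffunE inordK // le_n'.
apply: (@energy_inj _ _ _ _ _ _ phi).
- move=> u v Su Sv e; apply/ffunP => i; apply: val_inj => /=.
  by rewrite -(phiE u i Su) -(phiE v i Sv) e.
- move=> u Su; apply/forallP => i; have /forallP/(_ i)/andP[sm _] := Su.
  by rewrite /smooth_le /= phiE // sm ler_nat -ltnS le_n' //; exact: (forallP Su).
suff E u : ffun_dom (fun _ : 'I_s => smooth_le n Y Q) u ->
    ffun_sum (fun=> @kth_power k n') (phi u) = ffun_sum (fun=> @kth_power k n) u.
  by move=> u v Su Sv; rewrite !E.
by move=> Su; apply: eq_bigr => i _; rewrite /kth_power phiE.
Qed.

(** One variable forgets that it is smooth and becomes the argument of X^k. *)
Lemma momentS_le (s n Y : nat) :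
  (moment k s.+1 n Y (n%:R : R) <= diff_moment k s n Y (n%:R : R) ('X^k)%R)%N.
Proof.
pose phi (u : {ffun 'I_s.+1 -> 'I_n.+1}) : 'I_n.+1 * {ffun 'I_s -> 'I_n.+1} :=
  (u ord0, [ffun i => u (lift ord0 i)]).
apply: (@energy_inj _ _ _ _ _ _ phi).
- move=> u v _ _ [e0 /ffunP e]; apply/ffunP => i.
  case: (unliftP ord0 i) => [j ->|-> //].
  by have := e j; rewrite !ffunE.
- move=> u /forallP Su /=; rewrite /positive_ord /= (smooth_le_gt0 (Su ord0)) /=.
  by apply/forallP => i; rewrite ffunE.
suff E u : (eval_poly 'X^k (phi u).1 + ffun_sum (fun=> @kth_power k n) (phi u).2 =
    ffun_sum (fun=> @kth_power k n) u)%N by move=> u v _ _; rewrite !E.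
rewrite /ffun_sum big_ord_recl /eval_poly hornerXn; congr (_ + _)%N.
by apply: eq_bigr => i _; rewrite ffunE.
Qed.

Definition level_iter (nu : R) (r : nat) : R :=
  iter r (fun x => nu * (1 + x) / (2 * k%:R)) 1.

Lemma level_iter_itv (nu : R) (r : nat) : 0 <= nu <= k%:R ->
  0 <= level_iter nu r <= 1.
Proof.
move=> /andP[nu0 nuk]; elim: r => [|r /andP[x0 x1]] /=; first by rewrite ler01 lexx.
rewrite -/(level_iter nu r); set x := level_iter nu r in x0 x1 *.
rewrite divr_ge0 ?mulr_ge0 ?addr_ge0 //= ler_pdivrMr ?mulr_gt0 // mul1r mulrC.
by rewrite ler_pM // ?addr_ge0 //; lra.
Qed.

Lemma moment_exponentS (s : nat) (lam : R) :
    (0 < s)%N -> s%:R <= lam -> lam <= 2 * s%:R -> 2 * s%:R - lam <= k%:R ->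
    moment_exponent k s lam ->
  moment_exponent k s.+1 (lam + 1 + level_iter (2 * s%:R - lam) k).
Proof.
move=> s0 s_lam lam_s nuk adm; set nu := 2 * s%:R - lam.
have nuI : 0 <= nu <= k%:R by rewrite subr_ge0 lam_s.
have lev r : (r <= k)%N -> level_exponent k s lam r (level_iter nu r).
  elim: r => [_|r IHr rk]; first exact: level_exponent0.
  by apply: level_exponentS => //; [exact: level_iter_itv | exact/IHr/ltnW].
move=> eps eps0; have [a aP] := lev k (leqnn k) eps eps0; exists a.
move=> n Y Q n0 Y2 Q1 Qn; set n' := Num.truncn Q.
have Q0 : 0 <= Q by exact: le_trans Q1.
have n'0 : (0 < n')%N by rewrite truncn_gt0.
have n'Q : n'%:R <= Q by rewrite truncn_le.
apply: (@le_trans _ _ (diff_moment k s n' Y (n'%:R : R) ('X^k)%R)%:R).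
  by rewrite ler_nat (leq_trans (moment_truncn _ _ _ _)) // momentS_le.
apply: le_trans (aP n' Y n'%:R _ n'0 Y2 _ (lexx _) (weyl_polyXn k n')) _.
  by rewrite divff ?lt0r_neq0 // powRr1.
have n'R : 0 < n'%:R :> R by rewrite ltr0n.
have [x0 _] := andP (level_iter_itv k nuI).
have lam0 : 0 <= lam by exact: le_trans s_lam.
have -> : n'%:R * n'%:R `^ lam * n'%:R `^ level_iter nu k =
    n'%:R `^ (lam + 1 + level_iter nu k) :> R.
  by rewrite !powR_gt0D // powRr1 // [n'%:R * _]mulrC.
apply: ler_pM.
- by rewrite mulr_ge0 ?exprn_ge0 ?powR_ge0.
- exact: powR_ge0.
- rewrite ler_wpM2l ?exprn_ge0 // ge0_ler_powR ?nnegrE ?(ltW eps0) //.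
  exact: le_trans Qn.
by rewrite ge0_ler_powR ?nnegrE ?addr_ge0.
Qed.

Definition delta_step (d : R) : R :=
  d - 2 / k%:R * (d / (1 + d)) * (1 - 2 ^- k).

(** The index j belongs to s = j + 1. The start 1 - 1 / k corresponds to the moment exponent 1 for s
    = 1, where all solutions are diagonal. *)
Definition delta_seq (j : nat) : R := iter j delta_step (1 - k%:R^-1).

(** For nu = k (1 - d) the iterated map has the fixed point 1 - 2 d / (1 + d) and slope (1 - d) / 2
    <= 1 / 2, so the initial distance 2 d / (1 + d) at least halves at each step. This is the origin
    of 1 - 2^-k in [delta_step]. *)
Lemma level_iter_le (d : R) (r : nat) : 0 < d -> d <= 1 ->
  level_iter (k%:R * (1 - d)) r <= 1 - 2 * d / (1 + d) * (1 - 2 ^- r).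
Proof.
move=> d0 d1; have d10 : 0 < 1 + d by lra.
elim: r => [|r IHr] /=; first by rewrite expr0 invr1 subrr mulr0 subr0.
rewrite -/(level_iter _ r); set x := level_iter _ r in IHr *.
have -> : k%:R * (1 - d) * (1 + x) / (2 * k%:R) = (1 - d) / 2 * (1 + x).
  by field; rewrite gt_eqF.
set h : R := 2 ^- r in IHr *.
have h0 : 0 < h by rewrite invr_gt0 exprn_gt0.
have -> : 2 ^- r.+1 = h / 2 :> R by rewrite /h exprS invfM mulrC.
apply: (@le_trans _ _ ((1 - d) / 2 * (1 + (1 - 2 * d / (1 + d) * (1 - h))))).
  by rewrite ler_wpM2l ?lerD2l // divr_ge0 ?subr_ge0.
rewrite -subr_ge0.
have -> : 1 - 2 * d / (1 + d) * (1 - h / 2) -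
    (1 - d) / 2 * (1 + (1 - 2 * d / (1 + d) * (1 - h))) =
    d / (1 + d) * (d * h) by field; rewrite gt_eqF.
by rewrite !mulr_ge0 ?invr_ge0 ?ltW.
Qed.

Lemma delta_step_itv (d : R) : (1 < k)%N -> 0 < d <= 1 ->
  0 < delta_step d <= d.
Proof.
move=> k1 /andP[d0 d1]; have d10 : 0 < 1 + d by lra.
have h0 : 0 <= 1 - 2 ^- k :> R.
  by rewrite subr_ge0 invf_le1 ?exprn_gt0 ?exprn_ege1 ?ler1n.
have h1 : 1 - 2 ^- k < 1 :> R by rewrite gtrBl invr_gt0 exprn_gt0.
have k2 : 2 / k%:R <= 1 :> R by rewrite ler_pdivrMr // mul1r ler_nat.
have g0 : 0 < d / (1 + d) by rewrite divr_gt0.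
have gd : d / (1 + d) < d.
  by rewrite ltr_pdivrMr // mulrDr mulr1 ltrDl mulr_gt0.
apply/andP; split; last first.
  by rewrite gerBl !mulr_ge0 ?invr_ge0 ?(ltW g0) ?(ltW kR) ?(ltW d0) ?(ltW d10).
rewrite subr_gt0; apply: le_lt_trans gd.
apply: (@le_trans _ _ (1 * (d / (1 + d)) * 1)); last by rewrite mul1r mulr1.
apply: ler_pM; [| exact: h0 | | exact: ltW h1].
- by rewrite mulr_ge0 ?(ltW g0) // divr_ge0.
- by rewrite ler_wpM2r ?(ltW g0).
Qed.

Lemma delta_seq_itv (j : nat) : (1 < k)%N -> 0 < delta_seq j <= 1.
Proof.
move=> k1; elim: j => [|j IHj] /=.
  rewrite subr_gt0 invf_lt1 // ltr1n k1 gerBl invr_ge0 ltW //.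
have /andP[-> le] := delta_step_itv k1 IHj.
by rewrite (le_trans le) //; case/andP: IHj.
Qed.

(** The inequality s <= lam is carried through the induction because [moment_exponentS] requires
    it. *)
Lemma moment_exponent_delta (j : nat) : (1 < k)%N ->
  moment_exponent k j.+1 (2 * j.+1%:R - k%:R + k%:R * delta_seq j) /\
  j.+1%:R <= 2 * j.+1%:R - k%:R + k%:R * delta_seq j.
Proof.
move=> k1; elim: j => [|j [IHm IHle]].
  have -> : 2 * 1%:R - k%:R + k%:R * delta_seq 0 = 1 :> R.
    by rewrite /delta_seq /=; field; rewrite gt_eqF.
  by split=> //; exact: moment_exponent1.
have /andP[d0 d1] := delta_seq_itv j k1.
rewrite [delta_seq j.+1]/= -/(delta_seq j).
set d := delta_seq j in IHm IHle d0 d1 *; set lam := _ + _ in IHm IHle.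
have d10 : 0 < 1 + d by rewrite addr_gt0.
have nuE : 2 * j.+1%:R - lam = k%:R * (1 - d) by rewrite /lam; ring.
have nu0 : 0 <= k%:R * (1 - d) by rewrite mulr_ge0 ?subr_ge0 ?(ltW kR).
have := @level_iter_le d k d0 d1; rewrite -nuE => itle.
have stepE : 2 * j.+2%:R - k%:R + k%:R * delta_step d =
    lam + 1 + (1 - 2 * d / (1 + d) * (1 - 2 ^- k)).
  rewrite /lam /delta_step -[j.+2%:R]natr1; set h := 2 ^- k.
  by field; rewrite !gt_eqF.
have nuk : 2 * j.+1%:R - lam <= k%:R.
  by rewrite nuE ler_piMr ?(ltW kR) // gerBl ltW.
have lam2 : lam <= 2 * j.+1%:R by rewrite -subr_ge0 nuE.
have it0 : 0 <= level_iter (2 * j.+1%:R - lam) k.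
  have I : 0 <= 2 * j.+1%:R - lam <= k%:R by rewrite subr_ge0 lam2.
  by have /andP[] := level_iter_itv k I.
split; last first.
  by rewrite stepE -natr1 -[leLHS]addr0 lerD ?lerD2r // (le_trans it0).
rewrite stepE; apply: moment_exponent_le (moment_exponentS _ _ _ _ IHm) => //.
by rewrite lerD2l.
Qed.

End MomentIteration.

(** * The curve delta_t and the Euler polygon *)

Section DeltaCurve.
Local Open Scope ring_scope.
Variable R : realType.

Lemma add_ln_ltr (a b : R) : 0 < a -> a < b -> a + ln a < b + ln b.
Proof.
move=> a0 ab; have b0 := lt_trans a0 ab.
by rewrite ltrD // ltr_ln ?posrE.
Qed.

Lemma add_ln_inj (a b : R) : 0 < a -> 0 < b -> a + ln a = b + ln b -> a = b.
Proof.
move=> a0 b0 e; case: (ltgtP a b) => // [ab|ba].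
  by have := add_ln_ltr a0 ab; rewrite e ltxx.
by have := add_ln_ltr b0 ba; rewrite e ltxx.
Qed.

Lemma add_ln_le (a b : R) : 0 < b -> a + ln a <= b + ln b -> a <= b.
Proof.
move=> b0; apply: contraTle => ba; rewrite -ltNge; exact: add_ln_ltr.
Qed.

Lemma add_ln_surj (v : R) : exists2 d, 0 < d & d + ln d = v.
Proof.
(* Since a <= 1, the function is at most -|v| at [a]; since b >= 1, it is at least |v| at [b]. *)
pose a : R := expR (- (`|v| + 1)); pose b : R := `|v| + 1.
have a0 : 0 < a by exact: expR_gt0.
have b1 : 1 <= b by rewrite lerDr.
have a1 : a <= 1 by rewrite -expR0 ler_expR oppr_le0 addr_ge0.
have ab : a <= b by exact: le_trans a1 b1.
have [vl vu] : - `|v| <= v /\ v <= `|v| by split; rewrite ?ler_norm // lerNl -normrN ler_norm.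
have fa : a + ln a <= v by rewrite /a expRK -/a; lra.
have fb : v <= b + ln b by rewrite (le_trans vu) // (le_trans _ (_ : b <= _)) ?lerDl ?ln_ge0 // lerDl.
have fab : a + ln a <= b + ln b by exact: le_trans fb.
have := @IVT R (fun d => d + ln d) a b v ab.
rewrite /= (min_idPl fab) (max_idPr fab) fa fb => /(_ _ isT)[].
  apply: continuous_in_subspaceT => x; rewrite inE /= in_itv /= => /andP[ax _].
  have x0 := lt_le_trans a0 ax.
  by apply: continuousD; [exact: cvg_id | exact: continuous_ln].
move=> c; rewrite in_itv /= => /andP[ac _] fc.
by exists c => //; exact: lt_le_trans ac.
Qed.

Lemma ln1B_le (x : R) : x < 1 -> ln (1 - x) <= - x.
Proof. by move=> x1; apply: le_ln1Dx; rewrite ltrN2. Qed.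

(** With y = x / 2 + x^2 / 8 one has 1 - x <= (1 - y)^2, so ln (1 - y) <= - y, doubled, already
    yields a second order term. *)
Lemma ln1B_le2 (x : R) : 0 <= x -> x < 1 -> ln (1 - x) <= - x - x ^+ 2 / 4.
Proof.
move=> x0 x1; pose y := x / 2 + x ^+ 2 / 8.
have xx : x ^+ 2 <= x by rewrite expr2 ler_piMr // ltW.
have y1 : y < 1 by rewrite /y; lra.
apply: (@le_trans _ _ (ln ((1 - y) * (1 - y)))).
  rewrite ler_ln ?posrE ?mulr_gt0 ?subr_gt0 // -subr_ge0.
  have -> : (1 - y) * (1 - y) - (1 - x) = x ^+ 3 / 8 + x ^+ 4 / 64.
    by rewrite /y; field.
  by rewrite addr_ge0 // divr_ge0 ?exprn_ge0.
rewrite lnM ?posrE ?subr_gt0 //.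
have := ln1B_le y1; rewrite /y; lra.
Qed.

(** The bound k >= 6 is decisive here: 60 <= 64, whereas 50 > 32. *)
Lemma expn2_ge (k : nat) : (6 <= k)%N -> (10 * k <= 2 ^ k)%N.
Proof.
elim: k => // k IHk; rewrite leq_eqVlt => /predU1P[<- //|k6].
have := IHk k6; rewrite ssrnat.expnS; lia.
Qed.

(** The left side is at most 4 / 5, the right side at least (63 / 64)^2. *)
Lemma sqr_margin (h K : R) : 0 < h -> 10 * K * h <= 1 -> h <= 64^-1 ->
  8 * K * h <= (1 - h) ^+ 2.
Proof. by move=> h0 Kh h64; have := sqr_ge0 h; rewrite !expr2; nra. Qed.

(** Linear bookkeeping with logarithms as variables: [lx] stands for ln (1 - x), [ld] for ln d, [b]
    for the second order gain and [a] for the deficit due to 2^-k. *)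
Lemma ln_step_le (x lx d ld c m a kk b : R) : lx <= - x - b ->
  d + ld + c <= 1 - m -> a <= b -> d * x + x = kk - a ->
  d * (1 - x) + (ld + lx) + (c + kk) <= 1 - m.
Proof. by move=> ? ? ? ?; lra. Qed.

Lemma ln_chord_le (y ly d ld c m a b : R) : ly <= - y ->
  d + ld + c <= 1 - m -> b <= m -> d * y + y = a - b ->
  d * (1 - y) + (ld + ly) <= 1 - (c + a).
Proof. by move=> ? ? ? ?; lra. Qed.

Variable k : nat.
Hypothesis k6 : (6 <= k)%N.

Let kR : 0 < k%:R :> R. Proof. by rewrite ltr0n (leq_trans _ k6). Qed.
Let k1 : (1 < k)%N. Proof. exact: leq_trans k6. Qed.

Let h : R := 2 ^- k.

Let h0 : 0 < h. Proof. by rewrite invr_gt0 exprn_gt0. Qed.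

Let kh : 10 * k%:R * h <= 1.
Proof.
by rewrite ler_pdivrMr ?exprn_gt0 // mul1r -natrX -natrM ler_nat expn2_ge.
Qed.

Let h64 : h <= 64^-1.
Proof.
rewrite lef_pV2 ?posrE ?exprn_gt0 // -[64]/((2 ^ 6)%:R) -natrX ler_nat.
by rewrite leq_exp2l.
Qed.

Let h1 : 0 <= 1 - h.
Proof. by rewrite subr_ge0 (le_trans h64) // invf_le1 ?ler1n ?ltr0n. Qed.

(* Along the Euler polygon with vertices delta_seq the function
   u + ln u + t / k stays below 1 with a margin 1 / (4 k^2); the second order
   term of the logarithm absorbs the error 2 ^- k of the truncated recursion. *)
Lemma delta_seq_potential (j : nat) :
  delta_seq R k j + ln (delta_seq R k j) + 2 * j.+1%:R / k%:R <=
  1 - (4 * k%:R ^+ 2)^-1.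
Proof.
elim: j => [|j IHj].
  (* The margin originates here, as the second order term of ln (1 - 1 / k). *)
  have k1R : k%:R^-1 < 1 :> R by rewrite invf_lt1 // ltr1n.
  have := ln1B_le2 (ltW (_ : 0 < k%:R^-1)) k1R; rewrite invr_gt0 => /(_ kR).
  rewrite /delta_seq /= exprVn.
  have -> : (4 * k%:R ^+ 2)^-1 = (k%:R ^+ 2)^-1 / 4 :> R by rewrite invfM mulrC.
  rewrite mulr1; lra.
have /andP[d0 d1] := delta_seq_itv R (ltnW k1) j k1.
rewrite [delta_seq R k j.+1]/= -/(delta_seq R k j); set d := delta_seq R k j in IHj d0 d1 *.
pose x := 2 / k%:R * (1 - h) / (1 + d).
have d10 : 0 < 1 + d by rewrite addr_gt0.
have dE : delta_step k d = d * (1 - x).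
  by rewrite /delta_step -/h /x; field; rewrite !gt_eqF.
have := delta_step_itv (ltnW k1) k1 (_ : 0 < d <= 1); rewrite d0 d1 => /(_ isT).
rewrite dE => /andP[dx0 _].
have x1 : x < 1 by rewrite -subr_gt0 -(pmulr_rgt0 _ d0).
have x0 : 0 <= x by rewrite !mulr_ge0 ?invr_ge0 ?(ltW kR) ?(ltW d10).
rewrite lnM ?posrE ?subr_gt0 //.
have lnx := ln1B_le2 x0 x1.
have xd : x * (1 + d) = 2 / k%:R * (1 - h) by rewrite /x divfK ?gt_eqF.
have xlow : (1 - h) / k%:R <= x.
  rewrite /x ler_pdivlMr //.
  have -> : 2 / k%:R * (1 - h) = (1 - h) / k%:R * 2 by ring.
  by rewrite ler_wpM2l ?divr_ge0 ?(ltW kR) //; lra.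
(* The product x (1 + d) falls short of 2 / k by 2 h / k. Since x >= (1 - h) / k, the gain x^2 / 4
   pays for this as soon as 8 k h <= (1 - h)^2. *)
have xsq : 2 * (k%:R^-1 * h) <= x ^+ 2 / 4.
  apply: (@le_trans _ _ (((1 - h) / k%:R) ^+ 2 / 4)); last first.
    rewrite ler_wpM2r //; apply: lerXn2r; rewrite ?nnegrE //.
    by rewrite divr_ge0 ?(ltW kR).
  have -> : 2 * (k%:R^-1 * h) = (8 * k%:R * h) / (4 * k%:R ^+ 2).
    by field; rewrite gt_eqF.
  have -> : ((1 - h) / k%:R) ^+ 2 / 4 = (1 - h) ^+ 2 / (4 * k%:R ^+ 2).
    by field; rewrite gt_eqF.
  rewrite ler_wpM2r ?invr_ge0 ?mulr_ge0 ?exprn_ge0 ?(ltW kR) //.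
  exact: sqr_margin.
have -> : 2 * j.+2%:R / k%:R = 2 * j.+1%:R / k%:R + 2 / k%:R :> R.
  by rewrite -[j.+2%:R]natr1; ring.
have xdE : d * x + x = 2 / k%:R - 2 * (k%:R^-1 * h).
  by rewrite -[d * x]mulrC -[X in _ + X]mulr1 -mulrDr addrC xd; ring.
exact: ln_step_le lnx IHj xsq xdE.
Qed.

(** The point on the chord is u = d (1 - tau x). The first order bound for ln (1 - tau x) leaves a
    deficit tau 2 h / k, which the margin 1 / (4 k^2) of [delta_seq_potential] covers. *)
Lemma delta_chord (j : nat) (t : R) :
    2 * j.+1%:R <= t -> t <= 2 * j.+2%:R ->
  let u := delta_seq R k j + (t - 2 * j.+1%:R) / 2 *
             (delta_seq R k j.+1 - delta_seq R k j) in
  0 < u /\ u + ln u <= 1 - t / k%:R.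
Proof.
move=> tl tu u; have /andP[d0 d1] := delta_seq_itv R (ltnW k1) j k1.
have pot := delta_seq_potential j.
rewrite {}/u [delta_seq R k j.+1]/= -/(delta_seq R k j).
set d := delta_seq R k j in pot d0 d1 *.
pose x := 2 / k%:R * (1 - h) / (1 + d).
have d10 : 0 < 1 + d by rewrite addr_gt0.
have dE : delta_step k d = d * (1 - x).
  by rewrite /delta_step -/h /x; field; rewrite !gt_eqF.
have := delta_step_itv (ltnW k1) k1 (_ : 0 < d <= 1); rewrite d0 d1 => /(_ isT).
rewrite dE => /andP[dx0 _].
have x1 : x < 1 by rewrite -subr_gt0 -(pmulr_rgt0 _ d0).
have x0 : 0 <= x by rewrite !mulr_ge0 ?invr_ge0 ?(ltW kR) ?(ltW d10).
pose tau := (t - 2 * j.+1%:R) / 2.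
have tau0 : 0 <= tau by rewrite divr_ge0 ?subr_ge0.
have tau1 : tau <= 1.
  by rewrite ler_pdivrMr //; move: tu; rewrite -[j.+2%:R]natr1; lra.
rewrite -/tau; have -> : d + tau * (d * (1 - x) - d) = d * (1 - tau * x) by ring.
have tx1 : tau * x < 1 by apply: le_lt_trans x1; rewrite ler_piMl.
split; first by rewrite mulr_gt0 ?subr_gt0.
rewrite lnM ?posrE ?subr_gt0 //.
have lnx := ln1B_le tx1.
have xd : x * (1 + d) = 2 / k%:R * (1 - h) by rewrite /x divfK ?gt_eqF.
have txd : d * (tau * x) + tau * x = tau * (2 / k%:R * (1 - h)) by rewrite -xd; ring.
have tE : t / k%:R = 2 * j.+1%:R / k%:R + tau * (2 / k%:R).
  by rewrite /tau; field; rewrite gt_eqF.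
have marg : tau * (2 / k%:R * h) <= (4 * k%:R ^+ 2)^-1.
  apply: (@le_trans _ _ (1 * (2 / k%:R * h))).
    by rewrite ler_wpM2r // !mulr_ge0 ?invr_ge0 ?(ltW kR) ?(ltW h0).
  have -> : 1 * (2 / k%:R * h) = (8 * k%:R * h) * (4 * k%:R ^+ 2)^-1.
    by field; rewrite gt_eqF.
  rewrite ler_piMl ?invr_ge0 ?mulr_ge0 ?exprn_ge0 ?(ltW kR) //.
  by apply: le_trans kh; rewrite ler_wpM2r ?(ltW h0) // ler_wpM2r ?(ltW kR) // ler_nat.
rewrite tE; apply: ln_chord_le lnx pot marg _; rewrite txd; ring.
Qed.

End DeltaCurve.

(** * Passage to the integral *)

Section IntegralAverage.
Local Open Scope ring_scope.
Local Open Scope classical_set_scope.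
Variable R : realType.
Local Notation mu := (@lebesgue_measure R).

Section Nonnegative.
Variable G : R -> R.
Hypotheses (cG : continuous G) (G0 : forall x, 0 <= G x).

Let mG (D : set R) : measurable_fun D (EFin \o G).
Proof.
apply: measurable_funTS; apply/measurable_EFinP; exact: continuous_measurable_fun.
Qed.

Let cGshift (a : R) : continuous (G \o shift a).
Proof.
move=> x; apply: continuous_comp; last exact: cG.
by apply: continuousD; [exact: cvg_id | exact: cvg_cst].
Qed.

Let mGshift (a : R) (D : set R) : measurable_fun D (fun x => G (x + a)).
Proof.
apply: measurable_funTS.
exact: continuous_measurable_fun (@cGshift a).
Qed.

Lemma integral_shift (a d : R) : 0 <= d ->
  (\int[mu]_(x in `[a, (d + a)%R[) (G x)%:E =
   \int[mu]_(x in `[0%R, d[) (G (x + a))%:E)%E.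
Proof.
move=> d0; have dE : (shift a : R -> R)^`() = cst 1.
  apply/funext => x; have dx := is_derive_shift x (1 : R) a.
  by rewrite derive1E derive_val.
have cs : continuous (shift a : R -> R).
  by move=> x; apply: continuousD; [exact: cvg_id | exact: cvg_cst].
have [c1 c2] : (forall x : R, shift a y @[y --> x^'+] --> shift a x) /\
    (forall x : R, shift a y @[y --> x^'-] --> shift a x).
  by split=> x; [apply: cvg_at_right_filter | apply: cvg_at_left_filter]; exact: cs.
have := @integration_by_substitution_increasing R (shift a) G 0 d d0.
rewrite dE [shift a 0]add0r.
rewrite integral_itv_bndo_bndc; last exact: mG.
rewrite integral_itv_bndo_bndc; last first.
  by apply/measurable_EFinP; exact: mGshift.
move=> ->.
- by apply: eq_integral => x _; rewrite /= mulr1.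
- by move=> x y _ _ xy; rewrite /= ltrD2r.
- by move=> x _; exact: cvg_cst.
- by apply/cvg_ex; exists 1; exact: cvg_cst.
- by apply/cvg_ex; exists 1; exact: cvg_cst.
- split; [by move=> x _; exact: ex_derive | exact: c1 | exact: c2].
exact: continuous_subspaceT.
Qed.

Lemma integral_split (d : R) (n : nat) : 0 <= d ->
  (\int[mu]_(x in `[0%R, (n%:R * d)%R[) (G x)%:E =
   \int[mu]_(x in `[0%R, d[) (\sum_(j < n) G (x + j%:R * d))%:E)%E.
Proof.
move=> d0; have -> : (\int[mu]_(x in `[0%R, d[) (\sum_(j < n) G (x + j%:R * d))%:E =
    \sum_(j < n) \int[mu]_(x in `[0%R, d[) (G (x + j%:R * d))%:E)%E.
  rewrite -ge0_integral_sum //.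
  - by apply: eq_integral => x _; rewrite sumEFin.
  - by move=> j; apply/measurable_EFinP; exact: mGshift.
  - by move=> j x _; rewrite lee_fin.
elim: n => [|n IHn]; first by rewrite mul0r set_itvco0 integral_set0 big_ord0.
rewrite big_ord_recr /= -IHn -integral_shift //.
have nd0 : 0 <= n%:R * d by rewrite mulr_ge0.
have nd1 : n%:R * d <= n.+1%:R * d by rewrite ler_wpM2r // ler_nat.
have -> : d + n%:R * d = n.+1%:R * d by rewrite -natr1 mulrDl mul1r addrC.
have -> : `[0%R, (n.+1%:R * d)%R[ = `[0%R, (n%:R * d)%R[ `|` `[(n%:R * d)%R, (n.+1%:R * d)%R[ :> set R.
  by apply: itv_bndbnd_setU; rewrite bnd_simp.
rewrite ge0_integral_setU //.
- exact: mG.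
- by move=> x _; rewrite lee_fin.
rewrite disj_set2E; apply/eqP/seteqP; split=> [x /= [xA xB]|//].
move: xA xB; rewrite !in_itv /= => /andP[_ x1] /andP[x2 _].
by move: (lt_le_trans x1 x2); rewrite ltxx.
Qed.

(** The interval [0, 1) consists of N translates of [0, 1 / N), so a bound N B for the sum over
    translates is integrated over a length 1 / N. *)
Lemma integral_le_average (N : nat) (B : R) : (0 < N)%N ->
    (forall x, \sum_(j < N) G (x + j%:R / N%:R) <= N%:R * B) ->
  (\int[mu]_(x in `[0%R, 1%R]) (G x)%:E <= B%:E)%E.
Proof.
move=> N0 GB; have NR : 0 < N%:R :> R by rewrite ltr0n.
rewrite -integral_itv_bndo_bndc; last exact: mG.
have e1 : 1 = N%:R * N%:R^-1 :> R by rewrite mulfV ?gt_eqF.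
rewrite [X in `[_, X[]e1 integral_split ?invr_ge0 //.
apply: (@le_trans _ _ (\int[mu]_(x in `[0%R, (N%:R^-1)%R[) (N%:R * B)%:E)%E).
  apply: ge0_le_integral => //.
  - by move=> x _; rewrite lee_fin sumr_ge0.
  - by apply/measurable_EFinP; apply: measurable_sum => j; exact: mGshift.
  - by move=> x _; rewrite lee_fin GB.
rewrite integral_cst //= lebesgue_measure_itv /= lte_fin invr_gt0 NR.
by rewrite -EFinD subr0 -EFinM lee_fin mulrAC mulfV ?mul1r // gt_eqF.
Qed.

End Nonnegative.
End IntegralAverage.

(** * Moments of the weighted Weyl sum *)

Section SmoothWeylSums.
Local Open Scope ring_scope.
Variable R : realType.

Lemma normc_sqrE (z : R[i]) :
  normc z ^+ 2 = complex.Re z ^+ 2 + complex.Im z ^+ 2.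
Proof. by case: z => a b /=; rewrite sqr_sqrtr // addr_ge0 ?sqr_ge0. Qed.

Lemma ReD (y z : R[i]) : complex.Re (y + z) = complex.Re y + complex.Re z.
Proof. by case: y; case: z. Qed.

Lemma ImD (y z : R[i]) : complex.Im (y + z) = complex.Im y + complex.Im z.
Proof. by case: y; case: z. Qed.

Lemma continuous_trig_sum (I : Type) (r : seq I) (Q : pred I) (c : I -> R[i])
    (f : I -> R) :
  let F (a : R) := \sum_(i <- r | Q i) c i * e_ (a * f i) in
  continuous (fun a : R => complex.Re (F a)) /\ continuous (fun a : R => complex.Im (F a)).
Proof.
have ct (g : R -> R) (b : R) : continuous g -> continuous (fun a : R => g (2 * pi * (a * b))).
  move=> cg a; apply: (@continuous_comp _ _ _ (fun a : R => 2 * pi * (a * b)) g).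
    by apply: cvgM; [exact: cvg_cst | apply: cvgM; [exact: cvg_id | exact: cvg_cst]].
  exact: cg.
have cterm i : continuous (fun a : R => complex.Re (c i * e_ (a * f i))) /\
    continuous (fun a : R => complex.Im (c i * e_ (a * f i))).
  case: (c i) => u v; split=> a /=.
    apply: cvgB; apply: cvgM; try exact: cvg_cst.
      exact: (ct cos (f i) (@continuous_cos R)).
    exact: (ct sin (f i) (@continuous_sin R)).
  apply: cvgD; apply: cvgM; try exact: cvg_cst.
    exact: (ct sin (f i) (@continuous_sin R)).
  exact: (ct cos (f i) (@continuous_cos R)).
pose F r (a : R) := \sum_(i <- r | Q i) c i * e_ (a * f i).
rewrite -[X in let G := X in _]/(F r); elim: r => [|i r [IH1 IH2]].
  have -> : F [::] = fun=> 0 by apply/funext => a; rewrite /F big_nil.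
  by split=> a; exact: cvg_cst.
have [c1 c2] := cterm i.
have [Qi|nQi] := boolP (Q i); last first.
  by have -> : F (i :: r) = F r by apply/funext => a; rewrite /F big_cons (negPf nQi).
have -> : F (i :: r) = fun a => c i * e_ (a * f i) + F r a.
  by apply/funext => a; rewrite /F big_cons Qi.
split.
  under eq_fun do rewrite ReD.
  by move=> a; apply: cvgD; [exact: c1 | exact: IH1].
under eq_fun do rewrite ImD.
by move=> a; apply: cvgD; [exact: c2 | exact: IH2].
Qed.

Lemma continuous_weyl_sqr (k : nat) (P Y : R) (w : nat -> R[i]) :
  continuous (fun a : R => normc (smooth_weyl_sum k P Y w a) ^+ 2).
Proof.
have [c1 c2] := @continuous_trig_sum nat (index_iota 1 (Num.truncn P).+1)
  (mem (smooth_numbers P Y)) w (fun n => n%:R ^+ k).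
under eq_fun do rewrite normc_sqrE.
move=> a; apply: cvgD.
  by apply: cvgM; exact: c1.
by apply: cvgM; exact: c2.
Qed.

(** A shift of alpha multiplies the weights by numbers of modulus 1, so the discrete bounds hold at
    every translate of the points j / N. *)
Lemma smooth_weyl_sum_shift (k : nat) (P Y : R) (w : nat -> R[i]) (a b : R) :
    0 <= P -> 0 <= Y ->
  smooth_weyl_sum k P Y w (a + b) =
  expsum (smooth_le (Num.truncn P) (Num.truncn Y) ((Num.truncn P)%:R : R))
    (fun x => w x * e_ (a * (x : nat)%:R ^+ k)) (@kth_power k (Num.truncn P)) b.
Proof.
move=> P0 Y0; set N := Num.truncn P.
have -> : smooth_weyl_sum k P Y w (a + b) =
    \sum_(0 <= n < N.+1 | n \in smooth_numbers P Y) w n * e_ ((a + b) * n%:R ^+ k).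
  have no0 : (0%N \in smooth_numbers P Y) = false by rewrite inE.
  by rewrite [RHS]big_mkcond [RHS]big_ltn // no0 /= add0r [LHS]big_mkcond.
rewrite big_mkord /expsum; apply: eq_big => x.
  rewrite inE /= /smooth_le /= /smooth_nat.
  have xN : (x <= N)%N by rewrite -ltnS.
  rewrite ler_nat xN andbT -truncn_ge_nat // xN /=; congr (_ && _).
  by apply: eq_all => l /=; rewrite truncn_ge_nat.
by move=> _; rewrite mulrDl e_D mulrA natrX.
Qed.

Lemma normc_le_weight_norm (P : R) (w : nat -> R[i]) (n : nat) :
  (0 < n)%N -> (n <= Num.truncn P)%N -> normc (w n) <= weight_norm P w.
Proof.
move=> n0 nP; rewrite /weight_norm.
apply: (@le_bigmax_seq _ R _ _ 0 n xpredT (fun n => normc (w n))) => //.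
by rewrite mem_index_iota n0 ltnS.
Qed.

Lemma smooth_weyl_moment_le (k s M : nat) (P Y a : R) (w : nat -> R[i]) :
    0 <= P -> 0 <= Y -> (s * Num.truncn P ^ k < M)%N ->
  \sum_(j < M) normc (smooth_weyl_sum k P Y w (a + j%:R / M%:R)) ^+ (2 * s) <=
  M%:R * (weight_norm P w ^+ (2 * s) *
    (moment k s (Num.truncn P) (Num.truncn Y) ((Num.truncn P)%:R : R))%:R).
Proof.
move=> P0 Y0 sM; under eq_bigr do rewrite smooth_weyl_sum_shift //.
apply: weighted_moment_le => [u|x Sx].
  apply: leq_ltn_trans sM; rewrite -[X in (_ <= X * _)%N](card_ord s).
  rewrite -sum_nat_const; apply: leq_sum => i _.
  by rewrite /kth_power; case: k => // k'; rewrite leq_exp2r // -ltnS.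
rewrite normcM normc_e mulr1 normc_le_weight_norm ?(smooth_le_gt0 Sx) //.
by rewrite -ltnS.
Qed.

(** Below the threshold b compare with the power 2 s, above it with 2 s + 2. A suitable b makes this
    as good as Hoelder's inequality between even moments, up to a constant. *)
Lemma powR_le_interp (x b t : R) (s : nat) : 0 <= x -> 0 < b ->
    2 * s%:R <= t -> t <= 2 * s.+1%:R -> 0 < t ->
  x `^ t <= b `^ (t - 2 * s%:R) * x ^+ (2 * s) +
            b `^ (t - 2 * s.+1%:R) * x ^+ (2 * s.+1).
Proof.
move=> x0 b0 st ts t0; have [xb|bx] := lerP x b.
  apply: ler_wpDr; first by rewrite mulr_ge0 ?powR_ge0 ?exprn_ge0.
  have [->|xp] := eqVneq x 0.
    by rewrite powR0 ?gt_eqF // mulr_ge0 ?powR_ge0 ?exprn_ge0.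
  have {}xp : 0 < x by rewrite lt0r xp.
  have -> : x `^ t = x `^ (t - 2 * s%:R) * x ^+ (2 * s).
    by rewrite -powR_mulrn // -powR_gt0D // natrM subrK.
  rewrite ler_wpM2r ?exprn_ge0 // ge0_ler_powR ?nnegrE ?subr_ge0 //.
  exact: ltW.
apply: ler_wpDl; first by rewrite mulr_ge0 ?powR_ge0 ?exprn_ge0.
have xp : 0 < x by exact: lt_trans bx.
have -> : x `^ t = x `^ (t - 2 * s.+1%:R) * x ^+ (2 * s.+1).
  by rewrite -powR_mulrn // -powR_gt0D // natrM subrK.
rewrite ler_wpM2r ?exprn_ge0 // -opprB !powRN lef_pV2 ?posrE ?powR_gt0 //.
by rewrite ge0_ler_powR ?nnegrE ?subr_ge0 // ltW.
Qed.

End SmoothWeylSums.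

Section WeylIntegral.
Local Open Scope ring_scope.
Variable R : realType.

Local Notation smooth_moment k s P Y :=
  (moment k s (Num.truncn P) (Num.truncn Y) ((Num.truncn P)%:R : R))%:R.

Lemma integral_weyl_le (k s : nat) (P Y t b : R) (w : nat -> R[i]) :
    0 <= P -> 0 <= Y -> 0 < b -> 2 * s%:R <= t -> t <= 2 * s.+1%:R -> 0 < t ->
  (\int[@lebesgue_measure R]_(alpha in `[0%R, 1%R]%classic)
       (normc (smooth_weyl_sum k P Y w alpha) `^ t)%:E
   <= (b `^ (t - 2 * s%:R) * (weight_norm P w ^+ (2 * s) * smooth_moment k s P Y) +
       b `^ (t - 2 * s.+1%:R) * (weight_norm P w ^+ (2 * s.+1) * smooth_moment k s.+1 P Y))%:E)%E.
Proof.
move=> P0 Y0 b0 st ts t0; set W := weight_norm P w.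
set B1 := b `^ (t - 2 * s%:R); set B2 := b `^ (t - 2 * s.+1%:R).
pose F a := normc (smooth_weyl_sum k P Y w a).
have cF2 := @continuous_weyl_sqr R k P Y w; rewrite -/(F _) in cF2.
pose G a := B1 * (F a ^+ 2) ^+ s + B2 * (F a ^+ 2) ^+ s.+1.
have F0 a : 0 <= F a by exact: normc_ge0.
have cG : continuous G.
  have cX (r : nat) : continuous (fun a => (F a ^+ 2) ^+ r).
    move=> a; apply: (@continuous_comp _ _ _ (fun a => F a ^+ 2) (fun x => x ^+ r)).
      exact: cF2.
    exact: exprn_continuous.
  by move=> a; apply: cvgD; apply: cvgM; [exact: cvg_cst | exact: cX | exact: cvg_cst | exact: cX].
have G0 a : 0 <= G a by rewrite addr_ge0 ?mulr_ge0 ?powR_ge0 ?exprn_ge0.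
pose M := (s.+1 * Num.truncn P ^ k).+1.
apply: (@le_trans _ _ (\int[@lebesgue_measure R]_(a in `[0%R, 1%R]%classic) (G a)%:E)%E).
  apply: ge0_le_integral => //.
  - by move=> a _; rewrite lee_fin powR_ge0.
  - apply: measurable_funTS; apply/measurable_EFinP.
    (* Continuity is known for the squared modulus, so measurability is derived from it. *)
    have -> : (fun a => F a `^ t) = (fun x => x `^ (t / 2)) \o (fun a => F a ^+ 2).
      apply/funext => a /=; rewrite -powR_mulrn // -powRrM; congr (_ `^ _).
      by field.
    apply: measurableT_comp; first exact: measurable_powR.
    exact: continuous_measurable_fun.
  - by apply: measurable_funTS; apply/measurable_EFinP; exact: continuous_measurable_fun.
  move=> a _; rewrite lee_fin /G -!exprM; exact: (@powR_le_interp R (F a) b t s (F0 a) b0 st ts t0).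
apply: (@integral_le_average R G cG G0 M) => // a.
rewrite big_split /= mulrDr -!mulr_sumr.
under eq_bigr do rewrite -exprM; under [X in _ + _ * X]eq_bigr do rewrite -exprM.
rewrite [M%:R * (B1 * _)]mulrCA [M%:R * (B2 * _)]mulrCA lerD // ler_wpM2l ?powR_ge0 //.
  by apply: smooth_weyl_moment_le => //; rewrite ltnS leq_mul2r leqnSn orbT.
exact: smooth_weyl_moment_le.
Qed.

(** One term of the interpolation with threshold W P^kap. Through [eta], the power Y^a costs at most
    P^(eps / 2). *)
Lemma moment_term_le (s a n : nat) (W P Y t kap lam eps eta m : R) :
    0 < W -> 1 <= P -> n%:R <= P -> 0 <= lam -> 0 < eps ->
    m <= (Num.truncn Y)%:R ^+ a * n%:R `^ (eps / 2) * n%:R `^ lam ->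
    0 <= Y -> Y <= P `^ eta -> eta * a%:R <= eps / 2 ->
  (W * P `^ kap) `^ (t - 2 * s%:R) * (W ^+ (2 * s) * m) <=
  W `^ t * P `^ (kap * (t - 2 * s%:R) + lam + eps).
Proof.
move=> W0 P1 nP lam0 eps0 mle Y0 YP eta_le.
have P0 : 0 < P by exact: lt_le_trans P1.
have mP : m <= P `^ (lam + eps).
  apply: le_trans mle _.
  have -> : lam + eps = eps / 2 + eps / 2 + lam by field.
  rewrite !powR_gt0D //; apply: ler_pM; rewrite ?mulr_ge0 ?exprn_ge0 ?powR_ge0 //; last first.
    by rewrite ge0_ler_powR ?nnegrE // ltW.
  apply: ler_pM; rewrite ?exprn_ge0 ?powR_ge0 //; last first.
    by rewrite ge0_ler_powR ?nnegrE ?divr_ge0 // ltW.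
  apply: (@le_trans _ _ ((P `^ eta) ^+ a)).
    apply: lerXn2r; rewrite ?nnegrE ?powR_ge0 //.
    by apply: le_trans YP; rewrite truncn_le.
  by rewrite -powR_mulrn ?powR_ge0 // -powRrM ler_powR.
rewrite powRM ?powR_ge0 ?(ltW W0) // -powRrM.
have -> : W `^ t = W `^ (t - 2 * s%:R) * W ^+ (2 * s).
  by rewrite -powR_mulrn ?(ltW W0) // -powR_gt0D // natrM subrK.
rewrite -[kap * _ + lam + eps]addrA (powR_gt0D _ (lam + eps)) //.
set p1 := W `^ (t - _); set p2 := P `^ (kap * _).
set q := P `^ (lam + eps); set v := W ^+ _.
have -> : p1 * p2 * (v * m) = p1 * v * p2 * m by ring.
have -> : p1 * v * (p2 * q) = p1 * v * p2 * q by ring.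
by rewrite ler_wpM2l // !mulr_ge0 ?powR_ge0 ?exprn_ge0 ?(ltW W0).
Qed.

End WeylIntegral.

Local Open Scope ring_scope.

Theorem theorem2p2 (R : realType) (k : nat) (t : R) (hk : (6 <= k)%N) (ht : 4 <= t) :
  exists delta : R,
    unique (fun d : R => 0 < d /\ d + ln d = 1 - t / k%:R) delta /\
    weight_uniform_admissible k t (k%:R * delta).
Proof.
have [delta d0 dE] := add_ln_surj (1 - t / k%:R).
exists delta; split.
  by split=> // d [d'0 d'E]; apply: add_ln_inj => //; rewrite dE d'E.
have k0 : (0 < k)%N by exact: leq_trans hk.
have k1 : (1 < k)%N by exact: leq_trans hk.
have t0 : 0 < t by apply: lt_le_trans ht; rewrite ltr0n.
(* The number s = j + 1 is the integer part of t / 2. *)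
have [j tl tu] : exists2 j : nat, 2 * j.+1%:R <= t & t <= 2 * j.+2%:R.
  exists (Num.truncn (t / 2)).-1; rewrite prednK.
  - by rewrite mulrC -ler_pdivlMr // truncn_le divr_ge0 // ltW.
  - by rewrite truncn_gt0 ler_pdivlMr // mul1r (le_trans _ ht) // ler_nat.
  - by rewrite mulrC -ler_pdivrMr // ltW // truncnS_gt.
  by rewrite truncn_gt0 ler_pdivlMr // mul1r (le_trans _ ht) // ler_nat.
set s := j.+1 in tl tu *.
have [u0 u_le] := delta_chord hk tl tu.
set u := _ + _ in u0 u_le.
have ud : u <= delta by apply: add_ln_le => //; rewrite dE.
have [adm1 lam1] := moment_exponent_delta R k0 j k1.
have [adm2 lam2] := moment_exponent_delta R k0 j.+1 k1.
pose L i : R := 2 * i.+1%:R - k%:R + k%:R * delta_seq R k i.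
rewrite -/(L j) in adm1 lam1; rewrite -/(L j.+1) in adm2 lam2.
(* This slope gives the two interpolation terms the same exponent of P, namely the one read off the
   chord at t. *)
pose kap : R := (L j.+1 - L j) / 2.
have E1 : kap * (t - 2 * s%:R) + L j = t - k%:R + k%:R * u.
  by rewrite /kap /L /u /s -[j.+2%:R]natr1; field.
have E2 : kap * (t - 2 * s.+1%:R) + L j.+1 = t - k%:R + k%:R * u.
  by rewrite /kap /L /u /s -[j.+2%:R]natr1; field.
move=> eps eps0; have eps20 : 0 < eps / 2 by rewrite divr_gt0.
have [a1 a1P] := adm1 _ eps20; have [a2 a2P] := adm2 _ eps20.
pose eta : R := eps / 2 / (a1 + a2).+1%:R.
have eta0 : 0 < eta by rewrite divr_gt0.
have eta_le a : (a <= (a1 + a2).+1)%N -> eta * a%:R <= eps / 2.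
  move=> aa; rewrite /eta mulrAC ler_pdivrMr ?ltr0n //.
  by rewrite ler_wpM2l ?ler_nat // ltW.
(* The constant 2 counts the two interpolation terms. *)
exists eta; split=> //; exists 2; split=> // P Y Y2 YP Yeta w.
have Y0 : 0 <= Y by exact: le_trans Y2.
have P2 : 2 <= P by exact: le_trans YP.
have P1 : 1 <= P by apply: le_trans P2; rewrite ler1n.
have P0 : 0 < P by exact: lt_le_trans P1.
have n0 : (0 < Num.truncn P)%N by rewrite truncn_gt0.
have Yn : (2 <= Num.truncn Y)%N by rewrite truncn_ge_nat.
have nP : (Num.truncn P)%:R <= P by rewrite truncn_le ltW.
have n1 : 1 <= (Num.truncn P)%:R :> R by rewrite ler1n.
have m1 := a1P _ _ _ n0 Yn n1 (lexx _); have m2 := a2P _ _ _ n0 Yn n1 (lexx _).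
set W := weight_norm P w.
have W0 : 0 <= W by rewrite /W /weight_norm; apply: bigmax_ge_id.
have main (b : R) (b0 : 0 < b) := integral_weyl_le k w (ltW P0) Y0 b0 tl tu t0.
(* For W = 0 the threshold W P^kap is not positive; with the threshold 1 both terms vanish. *)
rewrite le_eqVlt in W0; case/predU1P: W0 => [W0|W0].
  apply: le_trans (main 1 ltr01) _; rewrite -/W -W0 lee_fin.
  rewrite !expr0n /= !mul0r !mulr0 addr0.
  by rewrite !mulr_ge0 ?powR_ge0.
have b0 : 0 < W * P `^ kap by rewrite mulr_gt0 ?powR_gt0.
apply: le_trans (main _ b0) _; rewrite -/W lee_fin.
have Lj0 i : i.+1%:R <= L i -> 0 <= L i by exact: le_trans.
have b1 := moment_term_le s t kap W0 P1 nP (Lj0 _ lam1) eps0 m1 Y0 Yeta.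
have b2 := moment_term_le s.+1 t kap W0 P1 nP (Lj0 _ lam2) eps0 m2 Y0 Yeta.
rewrite E1 in b1; rewrite E2 in b2.
have {}b1 := b1 (eta_le _ (leqW (leq_addr _ _))).
have {}b2 := b2 (eta_le _ (leqW (leq_addl _ _))).
apply: le_trans (lerD b1 b2) _.
rewrite -[leRHS]mulrA [leRHS]mulr_natl [leRHS]mulr2n lerD // ler_wpM2l ?powR_ge0 // ler_powR //.
all: by rewrite lerD2r lerD2l ler_wpM2l.
Qed.
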